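(* Let $d\geq 3$. Take any integer $k\geq 1$ and any $\varepsilon\in(0,1]$. Let $\Lambda$ be an everywhere percolating subgraph of $\mathbb{Z}^d$. Then, almost surely, $\Lambda\cup\varphi_k(\varepsilon)$ is connected and transient.
   Context: A subgraph $\Lambda\subseteq\mathbb{Z}^d$ is everywhere percolating if every vertex of $\mathbb{Z}^d$ lies in an infinite connected component of $\Lambda$. Box percolation $\varphi_k(\varepsilon)$: for $z\in(2k\mathbb{Z})^d$ let $B_k^z=([-k,k]^d\cap\mathbb{Z}^d)+z$, let $E(B_k^z)$ be its induced edge set, and let $Q_k^z$ be the subgraph of $B_k^z$ with edge set $\{(x,y)\in E(B_k^z):\ \text{there is no }\ell\in\{1,\dots,d\}\text{ with }x_\ell=y_\ell=z_\ell-k\}$. Independently for every $z\in(2k\mathbb{Z})^d$, choose a uniformly random edge of $Q_k^z$ and declare it open with probability $\varepsilon$ (and otherwise it is not open); $\varphi_k(\varepsilon)$ is the set of open edges. A connected graph is transient if simple random walk on it is transient. *)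

(* Defs.v *)
From HB Require Import structures.
From mathcomp Require Import all_boot all_order all_algebra.
From mathcomp Require Import all_classical all_reals all_analysis.
Set Implicit Arguments.
Unset Strict Implicit.
Unset Printing Implicit Defensive.
Import Order.TTheory GRing.Theory Num.Theory numFieldNormedType.Exports.
Local Open Scope classical_set_scope.
Local Open Scope ring_scope.

Definition site (d : nat) := {ffun 'I_d -> int}.

Definition vadd d (x y : site d) : site d := [ffun j => x j + y j].
Definition unitv d (i : 'I_d) : site d := [ffun j => ((j == i) : nat)%:Z].
Definition shift d (x : site d) (i : 'I_d) (s : int) : site d :=
  [ffun j => x j + s * ((j == i) : nat)%:Z].

(* An (undirected) edge of Z^d is encoded uniquely as a pair (x, i) standing
   for the edge {x, x + e_i}.  A subgraph of Z^d (with vertex set Z^d) is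
   given by its edge set S : set (site d * 'I_d). *)
Definition edge_rel d (S : set (site d * 'I_d)) (x y : site d) : Prop :=
  exists i, (S (x, i) /\ y = shift x i 1) \/ (S (y, i) /\ x = shift y i 1).

Inductive reach (V : Type) (G : V -> V -> Prop) (x : V) : V -> Prop :=
| reach_refl : reach G x x
| reach_step y z : reach G x y -> G y z -> reach G x z.

Definition graph_connected (V : Type) (G : V -> V -> Prop) : Prop :=
  forall x y, reach G x y.

Definition everywhere_percolating d (S : set (site d * 'I_d)) : Prop :=
  forall x : site d, ~ finite_set [set y | reach (edge_rel S) x y].

Definition nbrs d (x : site d) : seq (site d) :=
  [seq shift x i s | i <- enum 'I_d, s <- [:: 1%R; (-1)%R]].

Definition degree d (G : site d -> site d -> Prop) (x : site d) : nat :=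
  count (fun y => `[< G x y >]) (nbrs x).

Definition srw_p (R : realType) d (G : site d -> site d -> Prop)
  (x y : site d) : R :=
  if `[< G x y >] then (degree G x)%:R^-1 else 0.

Fixpoint srw_pn (R : realType) d (G : site d -> site d -> Prop) (n : nat)
  (x y : site d) : R :=
  match n with
  | 0 => ((x == y) : nat)%:R
  | n'.+1 => \sum_(w <- nbrs x) srw_p R G x w * srw_pn R G n' w y
  end.

(* Transience (Woess' definition): the Green function
   G(x,x) = sum_n p^(n)(x,x) is finite, for every vertex x. *)
Definition transient (R : realType) d (G : site d -> site d -> Prop) : Prop :=
  forall x : site d, cvgn (series ((fun n => srw_pn R G n x x) : R^nat)).

(* A point of the box B_k^z is encoded by its offset a : 'I_d -> 'I_(2k+1)
   from the corner, i.e. the point z + (a - k).  An edge of the box is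
   encoded as (a, i) meaning {z + (a - k), z + (a - k) + e_i}. *)
Definition Qcode (d k : nat) := ({ffun 'I_d -> 'I_(2 * k).+1} * 'I_d)%type.

Definition qx d k (q : Qcode d k) (l : 'I_d) : int := (q.1 l)%:Z - k%:Z.
Definition qy d k (q : Qcode d k) (l : 'I_d) : int :=
  qx q l + ((l == q.2) : nat)%:Z.

(* edge set of Q_k^z (translated by -z): both endpoints in [-k,k]^d and no
   coordinate l with x_l = y_l = z_l - k. *)
Definition Qset (d k : nat) : {set Qcode d k} :=
  [set q | (qy q q.2 <= k%:Z) &&
           [forall l, ~~ ((qx q l == - k%:Z) && (qy q l == - k%:Z))]].

Definition edge_of d k (z : site d) (q : Qcode d k) : site d * 'I_d :=
  (vadd z [ffun l => qx q l], q.2).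

(* centre 2k w of the box indexed by w in Z^d, so z ranges over (2kZ)^d *)
Definition centre d (k : nat) (w : site d) : site d :=
  [ffun l => (2 * k)%:Z * w l].

Definition box_law (R : realType) d k (eps : R) (v : Qcode d k * bool) : R :=
  ((v.1 \in Qset d k) : nat)%:R / #|Qset d k|%:R *
  (if v.2 then eps else 1 - eps).

(* X w = (U_w, O_w): U_w the uniformly chosen edge of Q_k^{2kw}, O_w whether
   it is declared open.  Hypothesis: the X w are random variables, mutually
   independent, each with law box_law (which also makes U_w and O_w
   independent with the prescribed uniform / Bernoulli(eps) marginals). *)
Definition box_choices (R : realType) (dm : measure_display)
  (Omega : measurableType dm) (P : probability Omega R) d k (eps : R)
  (X : site d -> Omega -> Qcode d k * bool) : Prop :=
  (forall w v, measurable [set om | X w om = v]) /\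
  (forall (J : seq (site d)) (v : site d -> Qcode d k * bool), uniq J ->
     P (\bigcap_(w in [set` J]) [set om | X w om = v w]) =
     (\prod_(w <- J) box_law eps (v w))%:E).

Definition phi d k (Omega : Type) (X : site d -> Omega -> Qcode d k * bool)
  (om : Omega) : set (site d * 'I_d) :=
  [set e | exists w, (X w om).2 /\ e = edge_of (centre k w) (X w om).1].

(* Main.v *)
(** Write G for the sprinkled graph.

    Merging (Benjamini and Tassion).  In a box of radius n, sprinkle
    successively in T = 2d+1 concentric shells, from the outside inwards, each
    containing q^2 spheres that lie in distinct boxes of the box percolation.
    Every cluster reaches the boundary of the box by Lambda, hence crosses all
    the spheres.  If after stage t+1 some cluster has fewer than q^(t+1)
    vertices while all earlier clusters have at least q^t, then it is the union
    of fewer than q earlier clusters; on each of the q^2 spheres either it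
    contains the whole sphere, and then everything is connected, or some edge
    of the sphere leaves it and is closed.  A union bound over the families of
    q clusters bounds the probability of the latter by
    (2n+1)^(dq) (1-p)^(q^2).  As q^T exceeds the number of vertices, the centre
    is connected to its neighbours inside the box, except with
    probability superexponentially small in q, where n is of order q^2.

    Transience.  Let h be the Green function of the walk killed at time N, with
    pole x.  Its Dirichlet energy is at most deg(x) h(x).  By Borel-Cantelli,
    for large s the neighbours in Z^d of every point of a box with 2^s points
    are linked in G within distance O(s^2), so the energy of h on Z^d in this
    box is at most poly(s) times the energy on G.  Comparing the averages of h
    over boxes with 2^s and 2^(s+1) points, a telescoping sum that converges
    because d >= 3 gives h(x) <= C sqrt(deg(x) h(x)) with C independent of N,
    so that h(x) is bounded. *)

From HB Require Import structures.
From mathcomp Require Import all_boot all_order all_algebra.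
From mathcomp Require Import all_classical all_reals all_analysis.
From mathcomp Require Import zify ring lra.
Require Import Defs.
Set Implicit Arguments.
Unset Strict Implicit.
Unset Printing Implicit Defensive.
Import Order.TTheory GRing.Theory Num.Theory numFieldNormedType.Exports.
Local Open Scope classical_set_scope.
Local Open Scope ring_scope.

(** * Boxes and spheres *)

(* [lia] does not recognise [x l] as an integer atom: the type of the value of
   a finite function is only convertible to [int]. *)
Ltac site_lia :=
  rewrite /=; repeat match goal with
  | H : context [@fun_of_fin _ _ _ _ _] |- _ => revert H
  end;
  rewrite /=; repeat match goal with
  | |- context [@fun_of_fin ?A ?B ?C ?f ?l] =>
      let a := fresh "a" in
      generalize (@fun_of_fin A B C f l); intro a; cbv beta in a
  end; intros; lia.

Definition box d (c : site d) (n : nat) : seq (site d) :=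
  [seq vadd c [ffun l => (f l : nat)%:Z - n%:Z] |
    f : {ffun 'I_d -> 'I_(2 * n).+1} <- enum {ffun 'I_d -> 'I_(2 * n).+1}].

(** The distance of the sup norm, so that its spheres are the boundaries of cubes. *)
Definition dist d (c y : site d) : nat := (\max_(l < d) absz (y l - c l)%R)%N.

Lemma dist_leP d (c y : site d) n :
  reflect (forall l, (absz (y l - c l)%R <= n)%N) (dist c y <= n)%N.
Proof.
apply: (iffP (bigmax_leqP _ _ _)) => [h l|h l _]; exact: h.
Qed.

Lemma leq_dist d (c y : site d) l : (absz (y l - c l)%R <= dist c y)%N.
Proof. exact: (leq_bigmax_cond (F := fun l => absz (y l - c l)%R)). Qed.

Lemma dist_attained d (c y : site d) :
  (0 < d)%N -> exists l, absz (y l - c l)%R = dist c y.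
Proof.
rewrite -[d in (0 < d)%N]card_ord => d0.
by have [l hl] := bigop.eq_bigmax (fun l => absz (y l - c l)%R) d0; exists l.
Qed.

Lemma mem_box d (c y : site d) n : (y \in box c n) = (dist c y <= n)%N.
Proof.
apply/mapP/dist_leP => [[f _ ->] l|h].
  by rewrite !ffunE; move: (nat_of_ord _) (ltn_ord (f l)) => a; move: (c l) => b; site_lia.
exists [ffun l => inord (absz (y l - c l + n%:Z)%R)]; first by rewrite mem_enum.
by apply/ffunP => l; rewrite !ffunE inordK; move: (h l); move: (y l) (c l) => a b; site_lia.
Qed.

Lemma box_uniq d (c : site d) n : uniq (box c n).
Proof.
rewrite map_inj_uniq ?enum_uniq // => f g /ffunP fg; apply/ffunP => l.
by have := fg l; rewrite !ffunE => h; apply: val_inj => /=; site_lia.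
Qed.

Lemma size_box d (c : site d) n : size (box c n) = ((2 * n).+1 ^ d)%N.
Proof. by rewrite size_map -cardE card_ffun !card_ord. Qed.

Lemma dist_shift d (c y : site d) i s : (absz s <= 1)%N ->
  (dist c (shift y i s) <= (dist c y).+1)%N.
Proof.
move=> s1; apply/dist_leP => l; have := leq_dist c y l.
by rewrite ffunE; case: (l == i); site_lia.
Qed.

Lemma edge_rel_sym d (S : set (site d * 'I_d)) x y :
  edge_rel S x y -> edge_rel S y x.
Proof. by case=> i [h|h]; exists i; [right|left]. Qed.

Lemma edge_rel_sub d (S S' : set (site d * 'I_d)) x y :
  S `<=` S' -> edge_rel S x y -> edge_rel S' x y.
Proof. by move=> h [i [[/h ? ?]|[/h ? ?]]]; exists i; [left|right]. Qed.

Lemma shiftNK d (x : site d) i : shift (shift x i 1) i (-1) = x.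
Proof. by apply/ffunP => l; rewrite !ffunE; case: (l == i) => /=; site_lia. Qed.

Lemma shiftKN d (x : site d) i : shift (shift x i (-1)) i 1 = x.
Proof. by apply/ffunP => l; rewrite !ffunE; case: (l == i) => /=; site_lia. Qed.

Lemma edge_relE d (S : set (site d * 'I_d)) x y : edge_rel S x y ->
  exists i s, (s == 1 :> int) || (s == -1) /\ y = shift x i s.
Proof.
case=> i [[_ ->]|[_ ->]]; exists i; [exists 1|exists (-1)]; split=> //.
by rewrite shiftNK.
Qed.

Lemma dist_edge d (S : set (site d * 'I_d)) c x y : edge_rel S x y ->
  (dist c y <= (dist c x).+1)%N.
Proof.
move=> /edge_relE[i [s [hs ->]]]; apply: dist_shift; site_lia.
Qed.

(* Any point of the sphere is joined inside it to the corner [c + (s, .., s)]: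
   keep one extremal coordinate fixed while moving all the others to [s]. *)
Section Sphere.
Variables (d : nat) (c : site d) (s : nat) (f : site d -> bool).
Hypothesis d2 : (2 <= d)%N.
Hypothesis fE : forall x i, dist c x = s -> dist c (shift x i 1) = s ->
  f x = f (shift x i 1).

Let setc (y : site d) i (a : int) : site d :=
  [ffun l => if l == i then a else y l].

Let dist_setc y i a : (dist c y <= s)%N -> (absz (a - c i)%R <= s)%N ->
  (exists2 j, j != i & absz (y j - c j)%R = s) -> dist c (setc y i a) = s.
Proof.
move=> ys ha [j ji hj]; apply/eqP; rewrite eqn_leq; apply/andP; split.
  apply/dist_leP => l; rewrite ffunE; case: eqP => [->//|_].
  by move/dist_leP : ys; apply.
by rewrite -hj; have := leq_dist c (setc y i a) j; rewrite ffunE (negPf ji).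
Qed.

Let f_setcD y i (n : nat) : (dist c y <= s)%N ->
  (absz (y i + n%:Z - c i)%R <= s)%N ->
  (exists2 j, j != i & absz (y j - c j)%R = s) -> f y = f (setc y i (y i + n%:Z)).
Proof.
move=> ys + hj; elim: n => [_|n IH hn].
  by congr f; apply/ffunP => l; rewrite ffunE addr0; case: eqP => [->|].
have yi : (absz (y i - c i)%R <= s)%N by move/dist_leP : ys; apply.
have hn' : (absz (y i + n%:Z - c i)%R <= s)%N by site_lia.
rewrite IH // (@fE _ i) ?dist_setc //.
  by congr f; apply/ffunP => l; rewrite !ffunE; case: eqP => _ /=; site_lia.
rewrite [X in dist c X](_ : _ = setc y i (y i + n.+1%:Z)) ?dist_setc //.
by apply/ffunP => l; rewrite !ffunE; case: eqP => _ /=; site_lia.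
Qed.

Let f_setc y i a : (dist c y <= s)%N -> (absz (a - c i)%R <= s)%N ->
  (exists2 j, j != i & absz (y j - c j)%R = s) -> f y = f (setc y i a).
Proof.
move=> ys ha hj; have yi : (absz (y i - c i)%R <= s)%N by move/dist_leP : ys; apply.
have [h|h] := leP (y i) a.
  by rewrite (f_setcD (n := absz (a - y i)%R) (i := i)) //; [congr (f (setc _ _ _))|]; site_lia.
(* A decreasing move is an increasing one read from its other end [z]. *)
pose z := setc y i a.
have zE : setc z i (z i + (absz (y i - a)%R)%:Z) = y.
  by apply/ffunP => l; rewrite !ffunE eqxx; case: eqP => [->|//]; site_lia.
rewrite -[in LHS]zE -f_setcD //.
- by rewrite dist_setc.
- by rewrite ffunE eqxx; site_lia.
- by case: hj => j ji hj; exists j => //; rewrite ffunE (negPf ji).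
Qed.

Lemma sphere_const y z : dist c y = s -> dist c z = s -> f y = f z.
Proof.
suff H u : dist c u = s -> f u = f [ffun l => c l + s%:Z] by move=> /H -> /H ->.
move=> us; have [|i hi] := @dist_attained _ c u; first by site_lia.
rewrite us in hi.
pose F (L : seq 'I_d) := foldr (fun l v => setc v l (c l + s%:Z)) u L.
have HF L : i \notin L -> [/\ (dist c (F L) <= s)%N, F L i = u i,
   f u = f (F L) & forall l, l \in L -> F L l = c l + s%:Z].
  elim: L => [|l L IH]; first by rewrite us.
  rewrite inE negb_or => /andP[il /IH[h1 h2 h3 h4]] /=.
  have hj : exists2 j, j != l & absz (F L j - c j)%R = s by exists i => //; rewrite h2.
  split.
  - by rewrite dist_setc // ; site_lia.
  - by rewrite ffunE (negPf il).
  - by rewrite -f_setc //; site_lia.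
  - by move=> m; rewrite inE ffunE; case: eqP => [->//|_] /=; exact: h4.
have [|h1 h2 -> h4] := HF (enum (predC1 i)); first by rewrite mem_enum !inE eqxx.
set v := F _ in h1 h2 h4 *.
(* All coordinates but [i] are now extremal. One of them, [j], which exists because [d >= 2], keeps
   the point on the sphere while coordinate [i] moves in its turn. *)
have [j ji] : exists j : 'I_d, j != i.
  have [i0|i0] := eqVneq (val i) 0%N.
    by exists (Ordinal d2); rewrite -val_eqE /= i0.
  by exists (Ordinal (ltnW d2)); rewrite -val_eqE /= eq_sym.
rewrite (f_setc (i := i) (a := c i + s%:Z)) //; first 1 last.
- site_lia.
- exists j => //; rewrite h4; first site_lia.
  by rewrite mem_enum inE.
congr f; apply/ffunP => l; rewrite !ffunE; case: eqP => [->//|/eqP li].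
by rewrite h4 // mem_enum.
Qed.

End Sphere.

(** The induced graph lives on a finite type, so that [connect] and cardinals of clusters are
    available. *)
Definition brel d (c : site d) n (S : set (site d * 'I_d)) :
    rel (seq_sub (box c n)) :=
  fun u v => `[< edge_rel S (val u) (val v) >].

Lemma brel_sym d (c : site d) n S : symmetric (brel (c := c) (n := n) S).
Proof. by move=> u v; apply/asboolP/asboolP; exact: edge_rel_sym. Qed.

Lemma sub_brel d (c : site d) n (S S' : set (site d * 'I_d)) : S `<=` S' ->
  subrel (connect (brel (c := c) (n := n) S)) (connect (brel S')).
Proof.
move=> SS'; apply: connect_sub => u v /asboolP h; apply: connect1.
by apply/asboolP; exact: edge_rel_sub h.
Qed.

(** The cluster of [u] in [L] is infinite, hence leaves the finite ball of radius [s]. The distance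
    to [c] grows by at most one along an edge, so the last vertex before the first exit lies on the
    sphere, and the path stays in the box until then. *)
Lemma cross_sphere d (c : site d) n (L : set (site d * 'I_d)) s
    (u : seq_sub (box c n)) :
  everywhere_percolating L -> (s <= n)%N -> (dist c (val u) <= s)%N ->
  exists2 z : seq_sub (box c n), dist c (val z) = s & connect (brel L) u z.
Proof.
move=> Linf sn us.
have [w uw ws] : exists2 w, reach (edge_rel L) (val u) w & ~ (dist c w <= s)%N.
  apply: contrapT => h; apply: (Linf (val u)).
  apply: (@sub_finite_set _ _ [set` box c s]); last exact: finite_seq.
  move=> w uw /=; rewrite mem_box; apply: contrapT => ws.
  by apply: h; exists w.
suff [[v vw [ws' _]]|//] :
  (exists2 v : seq_sub (box c n), val v = w & (dist c w <= s)%N /\ connect (brel L) u v)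
  \/ exists2 z : seq_sub (box c n), dist c (val z) = s & connect (brel L) u z.
  by [].
elim: {ws} uw => [|y z uy [[v vy [ys uv]]|h] yz]; last by right.
  by left; exists u.
have [zs|zs] := leqP (dist c z) s.
  have zb : z \in box c n by rewrite mem_box (leq_trans zs).
  left; exists (SeqSub zb) => //; split => //.
  by apply: connect_trans uv (connect1 _); apply/asboolP; rewrite vy.
right; exists v => //; rewrite vy; have := dist_edge c yz; site_lia.
Qed.

(** * Merging of clusters *)

(** The offset from the corner of the box is a residue modulo [2k]. It is taken in [[1, 2k]] in the
    directions other than [i], because [Qset] excludes edges inside a lower face, and in
    [[0, 2k - 1]] in direction [i], because the second endpoint must stay in the box. *)
Lemma edge_cover d k (x : site d) (i : 'I_d) : (1 <= k)%N ->
  exists w, exists2 q, q \in Qset d k & edge_of (centre k w) q = (x, i).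
Proof.
move=> k1; pose K : int := (2 * k)%N%:Z.
pose m l := x l + k%:Z - (l != i : nat)%:Z.
have K0 : K != 0 by rewrite /K; lia.
have mE l : m l = (m l %/ K)%Z * K + (m l %% K)%Z by exact: divz_eq.
have r0 l : 0 <= (m l %% K)%Z by exact: modz_ge0.
have rK l : (m l %% K)%Z < K by have := ltz_mod (m l) K0; rewrite /K; lia.
pose a : {ffun 'I_d -> 'I_(2 * k).+1} :=
  [ffun l => inord (absz (m l %% K)%Z + (l != i))].
have aE l : (a l : nat)%:Z = (m l %% K)%Z + (l != i : nat)%:Z.
  rewrite ffunE inordK; move: (r0 l) (rK l); rewrite /K; case: (l != i) => /=; lia.
pose w : site d := [ffun l => (m l %/ K)%Z].
exists w, (a, i).
  rewrite inE; apply/andP; split.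
    rewrite /qy /qx /= eqxx aE eqxx /=; move: (r0 i) (rK i); rewrite /K; lia.
  apply/forallP => l; rewrite /qy /qx /= aE.
  move: (r0 l); set r := (_ %% _)%Z; clearbody r => rr; apply/negP => /andP[/eqP + /eqP].
  by case: (l == i) => /=; lia.
rewrite /edge_of /=; congr (_, _); apply/ffunP => l.
rewrite !ffunE /qx /= aE; have := mE l; rewrite mulrC /m /K.
set X := (_ %/ _)%Z; set Y := (_ %% _)%Z; move: X Y (x l) => X Y b; cbv beta in b.
by case: (l != i) => /=; lia.
Qed.

Lemma edge_of_dist d k c w (q : Qcode d k) x i :
  edge_of (centre k w) q = (x, i) ->
  (dist c x <= dist c (centre k w) + k)%N /\
  (dist c (centre k w) <= dist c x + k)%N.
Proof.
case=> <- _; split; apply/dist_leP => l.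
  have := leq_dist c (centre k w) l; have := ltn_ord (q.1 l).
  by rewrite /vadd !ffunE /qx; move: (nat_of_ord _) => r; site_lia.
have := leq_dist c (vadd (centre k w) [ffun l => qx q l]) l.
have := ltn_ord (q.1 l).
by rewrite /vadd !ffunE /qx; move: (nat_of_ord _) => r; site_lia.
Qed.

(** [C] is a union of clusters of [e]. Those that meet [A] are disjoint and have at least [m]
    vertices each, so there are fewer than [q] of them, and [f] lists their roots. *)
Lemma cluster_cover (V : finType) (e : rel V) (C A : {set V}) (m q : nat) y0 :
  connect_sym e -> (forall u, u \in A -> (m <= #|connect e u|)%N) ->
  (forall u v, u \in C -> connect e u v -> v \in C) ->
  (#|C| < q * m)%N -> y0 \in C -> y0 \in A ->
  exists f : {ffun 'I_q -> V}, (forall i, f i \in C) /\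
    forall u, u \in A -> (u \in C) = [exists i, connect e (f i) u].
Proof.
move=> es hm hC hq y0C y0A.
pose R := [set fingraph.root e u | u in C :&: A]%SET.
have Rm : (#|R| * m <= #|C|)%N.
  rewrite -[X in (_ <= X)%N]sum1_card.
  apply: (@leq_trans (\sum_(u in C | fingraph.root e u \in R) 1)%N); last first.
    rewrite [leqRHS](bigID (fun u => fingraph.root e u \in R)) /=.
    exact: leq_addr.
  rewrite (partition_big (fingraph.root e) (mem R)) /=; last by move=> u /andP[].
  rewrite -sum_nat_const; apply: leq_sum => r /imsetP[u].
  rewrite inE => /andP[uC uA] rE.
  apply: (leq_trans (hm _ uA)); rewrite -sum1_card.
  rewrite [leqRHS](eq_bigl (fun v => [&& v \in C, fingraph.root e v \in R &
      fingraph.root e v == r])); last first.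
    by move=> v; rewrite andbA.
  rewrite big_mkcond [leqRHS]big_mkcond; apply: leq_sum => v _.
  case: ifP => // uv.
  have -> : v \in C by apply: hC uv.
  have -> : fingraph.root e v = r.
    by rewrite rE; apply/eqP; rewrite (root_connect es) es.
  rewrite eqxx rE; case: imsetP => //; case; exists u => //.
  by rewrite inE uC.
have Rq : (#|R| <= q)%N.
  rewrite -ltnS ltnW //; have : (#|R| * m < q * m)%N by exact: leq_ltn_trans hq.
  by rewrite ltn_mul2r ltnS => /andP[].
have RC r : r \in R -> r \in C.
  case/imsetP => u; rewrite inE => /andP[uC _] ->; apply: hC uC _.
  exact: connect_root.
have y0R : fingraph.root e y0 \in R.
  by apply/imsetP; exists y0 => //; rewrite inE y0C.
have nthR i : nth (fingraph.root e y0) (enum R) i \in R.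
  have [h|h] := ltnP i (size (enum R)); last by rewrite nth_default.
  by rewrite -mem_enum mem_nth.
(* The default value, the root of [y0], pads the family to length [q] and is itself in [R]. *)
exists [ffun i : 'I_q => nth (fingraph.root e y0) (enum R) i]; split=> [i|u uA].
  by rewrite ffunE; exact: RC.
apply/idP/existsP => [uC|[i]]; last by rewrite ffunE; apply: hC; exact: RC.
have uR : fingraph.root e u \in R by apply/imsetP; exists u => //; rewrite inE uC.
have iq : (index (fingraph.root e u) (enum R) < q)%N.
  by apply: leq_trans Rq; rewrite cardE index_mem mem_enum.
exists (Ordinal iq); rewrite ffunE nth_index ?mem_enum //.
by rewrite es connect_root.
Qed.

(** A deterministic counterpart of [phi], limited to the boxes of [J], which makes conditioning on
    revealed choices possible. *)
Definition phiJ d k (J : seq (site d)) (v : site d -> Qcode d k * bool) :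
    set (site d * 'I_d) :=
  [set e | exists2 w, w \in J & (v w).2 /\ e = edge_of (centre k w) (v w).1].

Section Merge.
Variables (d k : nat) (c : site d) (q T : nat) (L : set (site d * 'I_d)).
Variables (W : seq (site d)).
Hypothesis (d2 : (2 <= d)%N) (k1 : (1 <= k)%N).
Hypothesis Linf : everywhere_percolating L.

(* Stage [t] (counted from 0) reveals the boxes of the box percolation whose
   centre lies at a distance in ]tau t.+1, tau t] from [c]; its spheres have
   the radii [rad t j], 4k apart, so that edges on two of them never belong to
   the same box. *)
Definition tau t := (4 * k * (q ^ 2 * (T - t))).+1.
Definition rad t j := (4 * k * (q ^ 2 * (T - t.+1) + j) + 2 * k).+1.
Definition revealed t := [seq w <- W | tau t < dist c (centre k w)]%N.
Notation V := (seq_sub (box c (tau 0))).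
Definition stage_graph t (v : site d -> Qcode d k * bool) := L `|` phiJ (revealed t) v.
Definition stage_rel t v : rel V := brel (stage_graph t v).
(** The family [f] is deterministic, so that a union bound over all families can replace the random
    clusters that make up a small one. *)
Definition cluster_union t v (f : {ffun 'I_q -> V}) (u : V) : bool :=
  [exists i, connect (stage_rel t v) (f i) u].
Definition sphere_boundary t v f s : set (site d * 'I_d) :=
  [set e | exists u u' : V, [/\ val u = e.1, val u' = shift e.1 e.2 1,
     dist c (val u) = s, dist c (val u') = s & cluster_union t v f u != cluster_union t v f u']].
(** The boundaries depend only on the boxes of [revealed t], while their edges are tested against
    the fresh boxes of the stage. *)
Definition stage_fails t f v : Prop := forall j, (j < q ^ 2)%N ->
  (exists e, sphere_boundary t v f (rad t j) e) /\
  (forall e, sphere_boundary t v f (rad t j) e -> ~ phiJ (revealed t.+1) v e).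

Lemma leq_tau t t' : (t <= t')%N -> (tau t' <= tau t)%N.
Proof. by move=> tt'; rewrite ltnS !leq_mul // leq_sub2l. Qed.

(** The margin [k] is that of [edge_of_dist]: a box with an edge on such a sphere has its centre in
    the shell of stage [t]. *)
Lemma rad_bounds t j : (t < T)%N -> (j < q ^ 2)%N ->
  (tau t.+1 + k < rad t j)%N /\ (rad t j + k <= tau t)%N.
Proof.
move=> tT jq; rewrite /rad /tau (_ : T - t = (T - t.+1).+1)%N; last by lia.
have : (4 * k * j.+1 <= 4 * k * (q ^ 2))%N by rewrite leq_mul.
rewrite mulnS !mulnDr.
set A := (4 * k * (q ^ 2 * _))%N; set B := (4 * k * j)%N.
set D := (4 * k * q ^ 2)%N; lia.
Qed.

Lemma stage_rel_sym t v : connect_sym (stage_rel t v).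
Proof. by apply: sym_connect_sym; exact: brel_sym. Qed.

Lemma stage_le t t' v : (t <= t')%N ->
  subrel (connect (stage_rel t v)) (connect (stage_rel t' v)).
Proof.
move=> tt'; apply: sub_brel => e [|[w]]; first by left.
rewrite mem_filter => /andP[tw wW] h; right; exists w => //.
by rewrite mem_filter wW (leq_ltn_trans _ tw) // leq_tau.
Qed.

Lemma L_stage t v : subrel (connect (brel L)) (connect (stage_rel t v)).
Proof. by apply: sub_brel => e; left. Qed.

(* Every Lambda-cluster of a vertex within distance [tau t.+1] crosses all
   spheres of stage [t]; a small cluster of stage [t.+1] is a union of fewer
   than [q] clusters of stage [t], and its boundary on each sphere that it does
   not fill contains no open edge. *)
Lemma cluster_growth v t : (forall t f, (t < T)%N -> ~ stage_fails t f v) -> (t <= T)%N ->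
  (forall y : V, (dist c (val y) <= tau t)%N -> (q ^ t <= #|connect (stage_rel t v) y|)%N)
  \/ (forall y z : V, (dist c (val y) <= tau t)%N -> (dist c (val z) <= tau t)%N ->
      connect (stage_rel t v) y z).
Proof.
move=> nbad; elim: t => [_|t IH tT].
  by left => y _; apply/card_gt0P; exists y; exact: connect0.
have {IH}[IH|IH] := IH (ltnW tT); last first.
  right => y z hy hz; apply: (stage_le (leqnSn t)).
  by apply: IH; apply: leq_trans (leq_tau (leqnSn t)).
apply: contrapT => /not_orP[/existsNP[y /not_implyP[hy /negP]]].
rewrite -ltnNge expnS => small; apply.
pose C := [set u | connect (stage_rel t.+1 v) y u]%SET.
pose A := [set u : V | (dist c (val u) <= tau t)%N]%SET.
have CE : #|C| = #|connect (stage_rel t.+1 v) y| by apply: eq_card => u; rewrite inE.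
have [||||||f [fC fA]] := @cluster_cover _ (stage_rel t v) C A (q ^ t) q y.
- exact: stage_rel_sym.
- by move=> u; rewrite inE; exact: IH.
- move=> u z; rewrite !inE => yu uz; apply: connect_trans yu _.
  exact: (stage_le (leqnSn t)).
- by rewrite CE.
- by rewrite inE connect0.
- by rewrite inE (leq_trans hy) // leq_tau.
have {nbad}/existsNP[j /not_implyP[jq]] := nbad t f tT.
have [rad1 rad2] := rad_bounds tT jq.
set s := rad t j in rad1 rad2 *.
have sA (u : V) : dist c (val u) = s -> u \in A by move=> us; rewrite inE us; lia.
have sn : (s <= tau 0)%N by have := leq_tau (leq0n t); lia.
have cross (u : V) : (dist c (val u) <= tau t.+1)%N ->
    exists2 z : V, dist c (val z) = s & connect (stage_rel t.+1 v) u z.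
  move=> hu; have [|z zs uz] := @cross_sphere _ _ _ _ s u Linf sn; first lia.
  by exists z => //; exact: L_stage.
have [p ps yp] := cross y hy.
have [[[x i] [u [u' [ux u'x us u's uu']]]]|nobdry] := pselect (exists e, sphere_boundary t v f s e).
  move=> h; exfalso; apply: h; split.
    by exists (x, i), u, u'.
  (* An open edge has both or none of its endpoints in the cluster [C], so it cannot belong to the
     boundary. *)
  move=> [x1 i1] [z [z' [zx z'x zs z's zz']]] zphi.
  move/negP : zz'; apply; apply/eqP.
  rewrite /cluster_union -!fA ?sA // !inE; apply/idP/idP => /connect_trans; apply.
    apply/connect1/asboolP; exists i1; left; rewrite zx z'x; split => //.
    by right.
  apply/connect1/asboolP; exists i1; right; rewrite zx z'x; split => //.
  by right.
(* Here sphere [j] has no boundary edge. It contains the point [p] of [C], hence lies entirely in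
   [C], and every cluster from the inner box crosses it. *)
move=> _ a b ha hb.
suff H u : (dist c (val u) <= tau t.+1)%N -> connect (stage_rel t.+1 v) y u.
  apply: connect_trans (H _ hb); rewrite stage_rel_sym; exact: H.
move=> /cross[z zs uz]; rewrite stage_rel_sym; apply: connect_trans uz _.
rewrite stage_rel_sym.
suff : z \in C by rewrite inE.
have pC : p \in C by rewrite inE.
rewrite fA ?sA //; rewrite fA ?sA // in pC.
(* [sphere_const] expects a function on all sites, so [cluster_union] is extended by [false] outside
   the box. *)
pose F x := [exists u : V, (val u == x) && cluster_union t v f u].
have FE (u0 : V) : F (val u0) = cluster_union t v f u0.
  apply/existsP/idP => [[u1 /andP[/eqP/val_inj -> //]]|hu].
  by exists u0; rewrite eqxx.
have inV x : dist c x = s -> exists u0 : V, val u0 = x.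
  move=> xs; have xb : x \in box c (tau 0) by rewrite mem_box xs.
  by exists (SeqSub xb).
rewrite -/(cluster_union t v f z) -FE (@sphere_const _ c s F d2 _ _ (val p)) ?FE //.
move=> x i xs xis; have [u0 u0E] := inV _ xs; have [u1 u1E] := inV _ xis.
rewrite -u1E -u0E !FE.
have [->//|h] := eqVneq (cluster_union t v f u0) (cluster_union t v f u1); exfalso; apply: nobdry.
by exists (x, i), u0, u1; rewrite u0E u1E.
Qed.

(** After the last stage, clusters of size [q ^ T] would exceed the number of vertices of the box,
    so only the second alternative of [cluster_growth] remains; its radius [tau T] is [1]. *)
Lemma all_connected v : ((2 * tau 0).+1 ^ d < q ^ T)%N ->
  (forall t f, (t < T)%N -> ~ stage_fails t f v) ->
  forall y z : V, (dist c (val y) <= 1)%N -> (dist c (val z) <= 1)%N ->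
  connect (stage_rel T v) y z.
Proof.
move=> big nbad y z hy hz; have [h|] := cluster_growth nbad (leqnn T); last first.
  by apply; [exact: leq_trans hy _|exact: leq_trans hz _].
exfalso; have := h y (leq_trans hy (ltn0Sn _)); rewrite leqNgt => /negP; apply.
apply: leq_ltn_trans big; apply: leq_trans (max_card _) _.
by rewrite card_seq_sub ?box_uniq // size_box.
Qed.

End Merge.

(** * Outer probability of finitely determined events *)

Section OuterBound.
Variables (R : realType) (dm : measure_display) (Omega : measurableType dm).
Variable P : probability Omega R.

(* An upper bound on the outer probability, so that the measurability of the
   event need not be discussed. *)
Definition outer_le (E : set Omega) (b : R) : Prop :=
  exists B, [/\ measurable B, E `<=` B & (P B <= b%:E)%E].

Lemma outer_le_sub E E' b b' : E `<=` E' -> b' <= b -> outer_le E' b' ->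
  outer_le E b.
Proof.
move=> EE' bb' [B [mB E'B PB]]; exists B; split=> //.
  exact: subset_trans E'B.
by rewrite (le_trans PB) // lee_fin.
Qed.

Lemma outer_le0 b : 0 <= b -> outer_le set0 b.
Proof. by move=> b0; exists set0; split=> //; rewrite measure0 lee_fin. Qed.

Lemma outer_leU E E' b b' : outer_le E b -> outer_le E' b' ->
  outer_le (E `|` E') (b + b').
Proof.
move=> [B [mB EB PB]] [B' [mB' EB' PB']]; exists (B `|` B'); split.
- exact: measurableU.
- exact: setUSS.
- by rewrite (le_trans (measureU2 _ _ _)) // EFinD leeD.
Qed.

Lemma outer_le_seq (I : eqType) (s : seq I) (E : I -> set Omega) (b : I -> R) :
  (forall i, i \in s -> outer_le (E i) (b i)) ->
  outer_le [set om | exists2 i, i \in s & E i om] (\sum_(i <- s) b i).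
Proof.
elim: s => [_|i s IH h].
  by rewrite big_nil; apply: outer_le_sub (outer_le0 (lexx 0)) => // om [].
rewrite big_cons; have /IH hs j : j \in s -> outer_le (E j) (b j).
  by move=> js; apply: h; rewrite inE js orbT.
apply: outer_le_sub (outer_leU (h i (mem_head _ _)) hs) => // om [j].
by rewrite inE => /orP[/eqP -> |js] Ej; [left|right; exists j].
Qed.

End OuterBound.

Section Law.
Variables (R : realType) (d k : nat) (eps : R).
Hypothesis eps01 : 0 < eps <= 1.
Hypothesis Q0 : (0 < #|Qset d k|)%N.

Lemma box_law_ge0 (v : Qcode d k * bool) : 0 <= box_law eps v :> R.
Proof.
rewrite /box_law mulr_ge0 ?divr_ge0 ?ler0n //.
by case/andP: eps01 => e0 e1; case: ifP => _; lra.
Qed.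

Lemma box_law_sum : \sum_(v : Qcode d k * bool) box_law eps v = 1 :> R.
Proof.
have Q1 : #|Qset d k|%:R != 0 :> R by rewrite pnatr_eq0 -lt0n.
rewrite -(pair_bigA _ (fun q b => box_law eps (q, b))) /=.
rewrite (eq_bigr (fun q => (q \in Qset d k : nat)%:R / #|Qset d k|%:R)); last first.
  by move=> q _; rewrite big_bool /box_law /= -mulrDr addrC subrK mulr1.
rewrite -mulr_suml -natr_sum [X in X%:R](_ : _ = #|Qset d k|) ?divff //.
by rewrite -sum1_card [RHS]big_mkcond; apply: eq_bigr => q _; case: (q \in _).
Qed.

End Law.

(** * Conditioning on the choices made in finitely many boxes *)

Section Reveal.
Variables (R : realType) (d k : nat) (eps : R).
Variables (dm : measure_display) (Omega : measurableType dm).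
Variables (P : probability Omega R) (X : site d -> Omega -> Qcode d k * bool).
Hypothesis eps01 : 0 < eps <= 1.
Hypothesis Q0 : (0 < #|Qset d k|)%N.
Hypothesis HX : box_choices P eps X.

(** [J1] holds the revealed boxes and [J2] the fresh ones, each of which must miss one prescribed
    outcome. These events serve as measurable covers. *)
Definition agree_avoid (J1 J2 : seq (site d)) (v x : site d -> Qcode d k * bool) :
  set Omega := [set om | (forall w, w \in J1 -> X w om = v w) /\
                         (forall w, w \in J2 -> X w om <> x w)].

Lemma agree_avoid_measurable J1 J2 v x : measurable (agree_avoid J1 J2 v x).
Proof.
have mX w u : measurable [set om | X w om = u] by case: HX => h _; exact: h.
elim: J1 => [|w J1 IH].
  elim: J2 => [|w J2 IH].
    by rewrite (_ : agree_avoid _ _ _ _ = setT) //; apply/seteqP; split.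
  rewrite (_ : agree_avoid _ _ _ _ =
    (~` [set om | X w om = x w]) `&` agree_avoid [::] J2 v x).
    by apply: measurableI => //; exact: measurableC.
  apply/seteqP; split=> om.
    move=> [h1 h2]; split; first exact: (h2 w (mem_head _ _)).
    by split=> // u uJ; apply: h2; rewrite inE uJ orbT.
  move=> [h1 [_ h2]]; split=> // u; rewrite inE => /orP[/eqP -> //|]; exact: h2.
rewrite (_ : agree_avoid _ _ _ _ =
  [set om | X w om = v w] `&` agree_avoid J1 J2 v x).
  exact: measurableI.
apply/seteqP; split=> om.
  move=> [h1 h2]; split; first exact: (h1 w (mem_head _ _)).
  by split=> // u uJ; apply: h1; rewrite inE uJ orbT.
move=> [h0 [h1 h2]]; split=> // u; rewrite inE => /orP[/eqP -> //|]; exact: h1.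
Qed.

(** By induction on [J2]: avoiding [x w] is the complement of agreeing with it, so the event is a
    difference of two events with [w] dropped or moved to [J1]. *)
Lemma prob_agree_avoid J1 J2 v x : uniq (J1 ++ J2) ->
  P (agree_avoid J1 J2 v x) =
  (\prod_(w <- J1) box_law eps (v w) * \prod_(w <- J2) (1 - box_law eps (x w)))%:E.
Proof.
elim: J2 J1 v => [|w J2 IH] J1 v.
  rewrite cats0 => uJ; rewrite big_nil mulr1; case: HX => _ <- //.
  congr (P _); apply/seteqP; split=> om /=; first by move=> [h _] u uJ1; exact: h.
  by move=> h; split.
rewrite uniq_catC /= mem_cat negb_or => /andP[/andP[wJ2 wJ1]].
rewrite uniq_catC => uJ.
pose v' u := if u == w then x w else v u.
have wv' u : u \in J1 -> v' u = v u.
  by move=> uJ1; rewrite /v'; case: eqP => // uw; rewrite uw (negPf wJ1) in uJ1.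
have sub : agree_avoid (w :: J1) J2 v' x `<=` agree_avoid J1 J2 v x.
  move=> om [h1 h2]; split=> // u uJ1.
  by rewrite -wv' //; apply: h1; rewrite inE uJ1 orbT.
rewrite (_ : agree_avoid J1 (w :: J2) v x =
  agree_avoid J1 J2 v x `\` agree_avoid (w :: J1) J2 v' x); last first.
  apply/seteqP; split=> om.
    move=> [h1 h2]; split.
      by split=> // u uJ'; apply: h2; rewrite inE uJ' orbT.
    move=> [h _]; apply: (h2 w (mem_head _ _)).
    by rewrite (h w (mem_head _ _)) /v' eqxx.
  move=> [[h1 h2] h]; split=> // u; rewrite inE => /orP[/eqP ->|]; last exact: h2.
  move=> Xw; apply: h; split=> // z; rewrite inE => /orP[/eqP ->|zJ].
    by rewrite /v' eqxx.
  by rewrite wv' //; exact: h1.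
have mA J v0 : measurable (agree_avoid J J2 v0 x) by exact: agree_avoid_measurable.
have -> : P (agree_avoid J1 J2 v x `\` agree_avoid (w :: J1) J2 v' x) =
    (P (agree_avoid J1 J2 v x) -
     P (agree_avoid J1 J2 v x `&` agree_avoid (w :: J1) J2 v' x))%E.
  by apply: measureD => //; rewrite (le_lt_trans (probability_le1 _ _)) ?ltry.
rewrite setIidr // !IH //; last first.
  by rewrite /= mem_cat negb_or wJ1 wJ2.
rewrite -EFinB !big_cons; congr (_%:E).
rewrite {1}/v' eqxx [in X in _ - X](eq_big_seq (fun u => box_law eps (v u))); last first.
  by move=> u /wv' ->.
by ring.
Qed.

(* [E] may be estimated conditionally on the choices made in the boxes of [J]. *)
Lemma outer_le_reveal (E : set Omega) (b : R) (J : seq (site d)) :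
  uniq J ->
  (forall v, outer_le P (E `&` [set om | forall w, w \in J -> X w om = v w])
     (\prod_(w <- J) box_law eps (v w) * b)) ->
  outer_le P E b.
Proof.
elim: J => [_ h|w J IH /= /andP[wJ uJ] h].
  have [q0 _] : exists q0, q0 \in Qset d k by apply/card_gt0P.
  have := h (fun=> (q0, true)); rewrite big_nil mul1r.
  by apply: outer_le_sub => // om Eom; split.
apply: IH => // v.
pose V := (Qcode d k * bool)%type.
pose v' (a : V) u := if u == w then a else v u.
have wv' a u : u \in J -> v' a u = v u.
  by move=> uJ1; rewrite /v'; case: eqP => // uw; rewrite uw (negPf wJ) in uJ1.
have := outer_le_seq (s := enum {: V}) (fun a _ => h (v' a)).
apply: outer_le_sub => [om [Eom hom]|].
  exists (X w om); first by rewrite mem_enum.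
  split=> // u; rewrite inE => /orP[/eqP ->|uJ']; first by rewrite /v' eqxx.
  by rewrite wv' // hom.
rewrite -mulr_suml big_enum /=.
rewrite (eq_bigr (fun a => box_law eps a * \prod_(u <- J) box_law eps (v u))).
  by rewrite -mulr_suml box_law_sum // mul1r lexx.
move=> a _; rewrite big_cons {1}/v' eqxx; congr (_ * _).
by apply: eq_big_seq => u /wv' ->.
Qed.

End Reveal.

(** * Probability that neighbours are not linked *)

(** Confinement to the box localises the energy along the path, and the bound on the length enters
    the Cauchy-Schwarz estimate of [linked_diff]. *)
Definition linked d (S : set (site d * 'I_d)) (c : site d) (n : nat)
    (y z : site d) : Prop :=
  exists p, [/\ path (fun u u' => `[< edge_rel S u u' >]) y p, last y p = z,
    all (mem (box c n)) (y :: p) & (size p <= (2 * n).+1 ^ d)%N].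

Lemma connect_linked d (c : site d) n S (y z : seq_sub (box c n)) :
  connect (brel S) y z -> linked S c n (val y) (val z).
Proof.
case/connectP=> p /shortenP[{}p yp up _ ->]; exists (map val p); split.
- by rewrite path_map.
- by rewrite last_map.
- by apply/allP => u; rewrite -map_cons => /mapP[v _ ->]; exact: valP.
rewrite size_map (leq_trans (leqnSn _)) // -(size_box c).
rewrite -(card_seq_sub (box_uniq c n)) -[(size p).+1]/(size (y :: p)).
by move/card_uniqP : up => <-; exact: max_card.
Qed.

Lemma linked_sub d (S S' : set (site d * 'I_d)) c n y z : S `<=` S' ->
  linked S c n y z -> linked S' c n y z.
Proof.
move=> SS' [p [yp zp bp sp]]; exists p; split=> //.
by apply: sub_path yp => u v /asboolP h; apply/asboolP; exact: edge_rel_sub h.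
Qed.

Definition cover_boxes d k n (c : site d) : seq (site d) :=
  box [ffun=> 0] (n + k + dist [ffun=> 0] c).

Lemma mem_cover_boxes d k n (c w : site d) : (1 <= k)%N ->
  (dist c (centre k w) <= n + k)%N -> w \in cover_boxes k n c.
Proof.
move=> k1 hw; rewrite mem_box; apply/dist_leP => l.
have := leq_trans (leq_dist c (centre k w) l) hw.
have := leq_dist [ffun=> 0] c l; rewrite !ffunE.
by move: (w l) (c l) => a b; cbv beta in a; cbv beta in b; nia.
Qed.

Section Stage.
Variables (R : realType) (d k : nat) (eps : R).
Variables (dm : measure_display) (Omega : measurableType dm).
Variables (P : probability Omega R) (X : site d -> Omega -> Qcode d k * bool).
Variables (c : site d) (q T : nat) (L : set (site d * 'I_d)).
Hypothesis (d2 : (2 <= d)%N) (k1 : (1 <= k)%N) (eps01 : 0 < eps <= 1).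
Hypothesis Linf : everywhere_percolating L.
Hypothesis HX : box_choices P eps X.

Let n := tau k q T 0.
Let W := cover_boxes k n c.
Let Xom om w := X w om.

Lemma Qset_gt0 : (0 < #|Qset d k|)%N.
Proof.
have [w [qq qQ _]] := @edge_cover d k [ffun=> 0] (Ordinal (ltnW d2)) k1.
by apply/card_gt0P; exists qq.
Qed.

Lemma phiJ_eq J (v v' : site d -> Qcode d k * bool) :
  (forall w, w \in J -> v w = v' w) -> phiJ J v = phiJ J v'.
Proof.
move=> vv'; apply/seteqP; split=> e [w wJ h]; exists w => //.
  by rewrite -vv'.
by rewrite vv'.
Qed.

(** Once the boxes of [revealed t] are known, the boundaries are deterministic. One boundary edge is
    picked on each of the [q ^ 2] spheres; these edges lie in distinct fresh boxes, and each box
    opens its edge independently with probability [eps / #|Qset d k|]. *)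
Lemma stage_fails_prob t (f : {ffun 'I_q -> seq_sub (box c n)}) : (t < T)%N ->
  outer_le P [set om | stage_fails (c := c) (q := q) (T := T) L W t f (Xom om)]
    ((1 - eps / #|Qset d k|%:R) ^+ (q ^ 2)).
Proof.
move=> tT; have Q0 := Qset_gt0.
have Q0' : 0 < #|Qset d k|%:R :> R by rewrite ltr0n.
have /andP[e0 e1] := eps01.
have p1 : eps / #|Qset d k|%:R <= 1.
  by rewrite ler_pdivrMr // mul1r (le_trans e1) // ler1n.
have uJ : uniq (revealed (d := d) k c q T W t) by rewrite filter_uniq // box_uniq.
apply: (@outer_le_reveal _ _ _ eps _ _ P X Q0 _ _ _ uJ) => v.
set J := revealed _ _ _ _ _ _.
pose rd j := rad k q T t j.
have Pi0 : 0 <= \prod_(w <- J) box_law eps (v w).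
  by apply: prodr_ge0 => w _; exact: box_law_ge0.
(* If some boundary is empty, the event is incompatible with the revealed choices. *)
have [hb|hb] := pselect (forall j, (j < q ^ 2)%N ->
    exists e, sphere_boundary (q := q) (T := T) L W t v f (rd j) e); last first.
  apply: outer_le_sub (outer_le0 P (lexx 0)) => [om [om1 om2]|]; last first.
    by rewrite mulr_ge0 // exprn_ge0 // subr_ge0.
  apply: hb => j jq; have [[e he] _] := om1 j jq; exists e.
  move: he; rewrite /sphere_boundary /cluster_union /stage_rel /stage_graph -/J.
  by rewrite (@phiJ_eq J (Xom om) v).
have [e he] : {e : nat -> site d * 'I_d & forall j, (j < q ^ 2)%N ->
    sphere_boundary (q := q) (T := T) L W t v f (rd j) (e j)}.
  apply: (@choice nat _ (fun j e => (j < q ^ 2)%N ->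
    sphere_boundary (q := q) (T := T) L W t v f (rd j) e)).
  move=> j; have [/hb[e he]|jq] := boolP (j < q ^ 2)%N; first by exists e.
  by exists ([ffun=> 0], Ordinal (ltnW d2)).
have [g hg] : {g : nat -> site d * Qcode d k & forall j,
    (g j).2 \in Qset d k /\ edge_of (centre k (g j).1) (g j).2 = e j}.
  apply: (@choice nat _ (fun j wq => wq.2 \in Qset d k /\
    edge_of (centre k wq.1) wq.2 = e j)) => j.
  have [w [qq qQ qe]] := edge_cover (e j).1 (e j).2 k1.
  by exists (w, qq); split => //; rewrite qe; case: (e j).
have gdist j : (j < q ^ 2)%N -> (dist c (centre k (g j).1) <= rd j + k)%N /\
    (rd j <= dist c (centre k (g j).1) + k)%N.
  move=> /he[u [u' [ux _ us _ _]]]; have [_ ge] := hg j.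
  have := @edge_of_dist d k c (g j).1 (g j).2 (e j).1 (e j).2.
  by rewrite ge; case: (e j) ux => x i /= <- /(_ erefl)[]; rewrite us.
pose J2 := [seq (g j).1 | j <- iota 0 (q ^ 2)].
(* The radii are [4k] apart, whereas a common box would bring them within [2k]. *)
have ginj i j : (i < q ^ 2)%N -> (j < q ^ 2)%N -> (g i).1 = (g j).1 -> i = j.
  move=> /gdist + /gdist + gij; rewrite gij.
  case=> h1 h2 [h3 h4]; move: h1 h2 h3 h4; rewrite /rd /rad !mulnDr.
  set D := dist _ _; set B0 := (4 * k * (q ^ 2 * _))%N => h1 h2 h3 h4.
  have : (4 * k * i <= 4 * k * j + 2 * k)%N by lia.
  have : (4 * k * j <= 4 * k * i + 2 * k)%N by lia.
  by nia.
have uJ2 : uniq J2.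
  rewrite map_inj_in_uniq ?iota_uniq // => i j; rewrite !mem_iota /=.
  exact: ginj.
have gtau j : (j < q ^ 2)%N -> (tau k q T t.+1 < dist c (centre k (g j).1))%N /\
    (dist c (centre k (g j).1) <= tau k q T t)%N.
  move=> jq; have [? ?] := rad_bounds d2 k1 tT jq; have := gdist j jq.
  by rewrite /rd; lia.
have uJJ2 : uniq (J ++ J2).
  rewrite cat_uniq uJ uJ2 andbT /=; apply/hasPn => w /mapP[j].
  rewrite mem_iota /= => jq ->; rewrite mem_filter negb_and -leqNgt.
  by have [_ ->] := gtau j jq.
(* The position of [w] in [J2] recovers the sphere, hence the edge whose opening is to be
   avoided. *)
pose x w := ((g (index w J2)).2, true).
have xg j : (j < q ^ 2)%N -> x (g j).1 = ((g j).2, true).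
  move=> jq; rewrite /x /J2 (_ : index _ _ = j) //.
  rewrite -[j in (g j).1](@nth_iota 0 0 (q ^ 2)) //.
  rewrite -(nth_map _ (g 0%N).1 (fun j => (g j).1)) ?size_iota //.
  by rewrite index_uniq // size_map size_iota.
exists (agree_avoid X J J2 v x); split.
- exact: (agree_avoid_measurable HX).
- move=> om [om1 om2]; split=> // w /mapP[j]; rewrite mem_iota /= => jq ->.
  rewrite xg // => Xg; have [_ /(_ (e j))] := om1 j jq; apply.
    move: (he j jq); rewrite /sphere_boundary /cluster_union /stage_rel /stage_graph -/J.
    by rewrite (@phiJ_eq J (Xom om) v).
  exists (g j).1; last by rewrite /Xom Xg; split=> //; have [_ ->] := hg j.
  have [t1 t2] := gtau j jq.
  rewrite mem_filter t1 /=; apply: mem_cover_boxes => //.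
  apply: leq_trans t2 _; apply: leq_trans (leq_addr _ _).
  exact: leq_tau.
rewrite (prob_agree_avoid HX) // lee_fin ler_wpM2l //.
rewrite (eq_big_seq (fun=> 1 - eps / #|Qset d k|%:R)); last first.
  move=> w /mapP[j]; rewrite mem_iota /= => jq ->; rewrite xg //.
  by rewrite /box_law /=; have [-> _] := hg j; rewrite mul1r mulrC.
by rewrite big_const_seq count_predT size_map size_iota iter_mulr_1.
Qed.

(** Union bound over the [T] stages and the families of [q] vertices of the box. *)
Lemma unlinked_prob : ((2 * n).+1 ^ d < q ^ T)%N ->
  outer_le P [set om | ~ forall i, linked (L `|` phi X om) c n c (shift c i 1)]
   (T%:R * ((2 * n).+1 ^ d)%:R ^+ q * (1 - eps / #|Qset d k|%:R) ^+ (q ^ 2)).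
Proof.
move=> big.
pose Ft := {ffun 'I_q -> seq_sub (box c n)}.
have H := @outer_le_seq _ _ _ P _ [seq (t, f) | t <- iota 0 T, f <- enum {: Ft}]
  (fun tf => [set om | stage_fails (c := c) (q := q) (T := T) L W tf.1 tf.2 (Xom om)])
  (fun=> (1 - eps / #|Qset d k|%:R) ^+ (q ^ 2)).
apply: outer_le_sub (H _).
move=> om hom.
  apply: contrapT => hno; apply: hom => i.
  have cn : c \in box c n.
    by rewrite mem_box; apply/dist_leP => l; site_lia.
  have cin : shift c i 1 \in box c n.
    rewrite mem_box (@leq_trans 1) //; apply/dist_leP => l.
    by rewrite !ffunE; case: (l == i); site_lia.
  apply: (@linked_sub _ (stage_graph c q T L W T (Xom om))).
    move=> e [|[w _ h]]; first by left.
    by right; exists w.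
  apply: (@connect_linked _ _ _ _ (SeqSub cn) (SeqSub cin)).
  apply: (all_connected d2 k1 Linf big) => [t f tT tbad||].
  - apply: hno; exists (t, f) => //; apply/allpairsP; exists (t, f).
    by rewrite mem_iota mem_enum.
  - by apply/dist_leP => l; site_lia.
  - by apply/dist_leP => l; rewrite !ffunE; case: (l == i); site_lia.
  rewrite big_const_seq count_predT iter_addr_0 size_allpairs size_iota.
rewrite -cardE card_ffun card_ord card_seq_sub ?box_uniq // size_box.
  by rewrite -[leLHS]mulr_natl natrM natrX.
  move=> [t f] /allpairsP[[t' f'] /= [+ _ [-> ->]]].
  by rewrite mem_iota /=; exact: stage_fails_prob.
Qed.

End Stage.

(** * Dirichlet energy *)

Lemma sum_support (R : nmodType) (I : eqType) (s1 s2 : seq I) (F : I -> R) :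
  uniq s1 -> uniq s2 -> (forall u, F u != 0 -> u \in s1) ->
  (forall u, F u != 0 -> u \in s2) -> \sum_(u <- s1) F u = \sum_(u <- s2) F u.
Proof.
move=> u1 u2 h1 h2.
have H s : \sum_(u <- s) F u = \sum_(u <- [seq u <- s | F u != 0]) F u.
  rewrite big_filter [RHS]big_mkcond; apply: eq_bigr => u _.
  by case: eqP => [->|].
rewrite H [RHS]H; apply: perm_big; apply: uniq_perm; rewrite ?filter_uniq //.
move=> u; rewrite !mem_filter; case: (boolP (F u != 0)) => //= /[dup] /h1 -> /h2.
by move=> ->.
Qed.

Lemma sum_le_support (R : numDomainType) (I : eqType) (s1 s2 : seq I)
    (F : I -> R) : uniq s1 -> uniq s2 -> (forall u, 0 <= F u) ->
  (forall u, F u != 0 -> u \in s2) -> \sum_(u <- s1) F u <= \sum_(u <- s2) F u.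
Proof.
move=> u1 u2 F0 h2; pose F' u := if u \in s1 then F u else 0.
rewrite (eq_big_seq F'); last by move=> u us; rewrite /F' us.
rewrite (@sum_support _ _ s1 s2) //.
- by apply: ler_sum => u _; rewrite /F'; case: ifP.
- by move=> u; rewrite /F'; case: ifP => //; rewrite eqxx.
- by move=> u; rewrite /F'; case: ifP => [_ /h2|]; rewrite ?eqxx.
Qed.

(** Cauchy-Schwarz, by induction; the cross term is controlled by the square of [n * F i - S]. *)
Lemma sqr_sum_le (R : realFieldType) (I : Type) (s : seq I) (F : I -> R) :
  (\sum_(i <- s) F i) ^+ 2 <= (size s)%:R * \sum_(i <- s) F i ^+ 2.
Proof.
elim: s => [|i s IH]; first by rewrite !big_nil mulr0 expr0n.
rewrite !big_cons /=.
have [/size0nil -> |s0] := posnP (size s).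
  by rewrite !big_nil !addr0 mul1r.
set S := \sum_(j <- s) _ in IH *; set Q := \sum_(j <- s) _ in IH *.
have n0 : 0 < (size s)%:R :> R by rewrite ltr0n.
rewrite -natr1; set n := (size s)%:R in n0 IH *.
suff : 2 * (F i * S) <= n * F i ^+ 2 + Q by move=> h; nra.
rewrite -(ler_pM2l n0); have := sqr_ge0 (n * F i - S).
by nra.
Qed.

Section Dirichlet.
Variables (R : realType) (d : nat) (S : set (site d * 'I_d)).
Notation G := (edge_rel S).

(** Each edge is counted once, at the endpoint [u] from which it points in a positive direction. *)
Definition energy (h : site d -> R) (u : site d) : R :=
  \sum_i (`[< G u (shift u i 1) >] : nat)%:R * (h u - h (shift u i 1)) ^+ 2.

(** Finite partial sums stand for the total Dirichlet energy, which avoids infinite sums. *)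
Definition energy_le (h : site d -> R) (D : R) : Prop :=
  forall B : seq (site d), uniq B -> \sum_(u <- B) energy h u <= D.

Lemma energy_ge0 h u : 0 <= energy h u.
Proof. by apply: sumr_ge0 => i _; rewrite mulr_ge0 ?ler0n ?sqr_ge0. Qed.

Lemma shift_inj i s : injective (fun u : site d => shift u i s).
Proof.
move=> u v /ffunP uv; apply/ffunP => l; have := uv l; rewrite !ffunE.
exact: addIr.
Qed.

Lemma mem_nbrs (y w : site d) : G y w -> w \in nbrs y.
Proof.
move=> /edge_relE[i [s [hs ->]]]; apply/allpairsP; exists (i, s).
by rewrite mem_enum !inE.
Qed.

Lemma degree_le (y : site d) : (degree G y <= 2 * d)%N.
Proof.
apply: leq_trans (count_size _ _) _.
by rewrite size_allpairs size_enum_ord /= mulnC.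
Qed.

Lemma degree_srw_p y w :
  (degree G y)%:R * srw_p R G y w = (`[< G y w >] : nat)%:R.
Proof.
rewrite /srw_p; case: asboolP => yw; last by rewrite mulr0.
rewrite divff // pnatr_eq0 -lt0n -has_count; apply/hasP; exists w.
  exact: mem_nbrs.
exact/asboolP.
Qed.

Lemma srw_p_ge0 y w : 0 <= srw_p R G y w.
Proof. by rewrite /srw_p; case: ifP. Qed.

Lemma srw_pn_ge0 n y w : 0 <= srw_pn R G n y w.
Proof.
elim: n y => [|n IH] y /=; first exact: ler0n.
by apply: sumr_ge0 => z _; rewrite mulr_ge0 ?srw_p_ge0.
Qed.

Lemma srw_pn_eq0 n y x : (n < dist x y)%N -> srw_pn R G n y x = 0.
Proof.
elim: n y => [|n IH] y /= hy.
  case: eqP hy => // -> /=; rewrite ltnNge => /negP[].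
  by apply/dist_leP => l; site_lia.
rewrite big_seq big1 // => w /allpairsP[[i s] /= [_ hs ->]].
rewrite IH ?mulr0 //.
have s1 : (absz (- s) <= 1)%N by move: hs; rewrite !inE => /orP[]/eqP ->.
have := dist_shift x (shift y i s) i s1; rewrite (_ : shift _ _ _ = y); first lia.
by apply/ffunP => l; rewrite !ffunE mulNr addrK.
Qed.

(** * Green function of the walk killed at time [N] *)

Section Green.
Variables (x : site d) (N : nat).

Definition green (y : site d) : R := \sum_(n < N) srw_pn R G n y x.

Lemma green_ge0 y : 0 <= green y.
Proof. by apply: sumr_ge0 => n _; exact: srw_pn_ge0. Qed.

Lemma green_eq0 y : (N <= dist x y)%N -> green y = 0.
Proof.
by move=> hy; apply: big1 => n _; rewrite srw_pn_eq0 // (leq_trans (ltn_ord n)).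
Qed.

(** Averaging over the first step shifts the time by one, so the sums telescope to the Dirac mass at
    [x] minus the nonnegative term [srw_pn R G N y x]. *)
Lemma green_superharmonic y :
  \sum_(w <- nbrs y) (`[< G y w >] : nat)%:R * (green y - green w) <=
  (degree G y)%:R * (y == x : nat)%:R.
Proof.
under eq_bigr do rewrite mulrBr.
rewrite big_split /= -mulr_suml sumrN.
have -> : \sum_(w <- nbrs y) (`[< G y w >] : nat)%:R = (degree G y)%:R :> R.
  rewrite -natr_sum; congr _%:R; rewrite /degree -sum1_count [RHS]big_mkcond.
  by apply: eq_bigr => w _; case: asboolP.
have -> : \sum_(w <- nbrs y) (`[< G y w >] : nat)%:R * green w =
    (degree G y)%:R * \sum_(n < N) srw_pn R G n.+1 y x.
  under eq_bigr do rewrite -degree_srw_p /green mulr_sumr.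
  rewrite exchange_big mulr_sumr; apply: eq_bigr => n _ /=.
  by rewrite mulr_sumr; apply: eq_bigr => w _; rewrite mulrA.
rewrite -mulrBr ler_wpM2l ?ler0n //.
have : green y + srw_pn R G N y x =
    (y == x : nat)%:R + \sum_(n < N) srw_pn R G n.+1 y x.
  by rewrite /green -(big_ord_recr N (fun n => srw_pn R G n y x)) /= big_ord_recl.
have := srw_pn_ge0 N y x; lra.
Qed.

(* Summation by parts; the killing term [srw_pn R G N] has the right sign. *)
Lemma energy_green : energy_le green ((degree G x)%:R * green x).
Proof.
have supp u : green u != 0 -> (dist x u <= N)%N.
  by apply: contraNT; rewrite -ltnNge => /ltnW/green_eq0 ->.
(* The radius exceeds that of the support by one, since the energy at [u] also involves
   [shift u i 1]. *)
pose C := box x N.+1.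
have uC : uniq C by exact: box_uniq.
have dsh u i : (dist x (shift u i 1) <= N)%N -> (dist x u <= N.+1)%N.
  move=> h; rewrite -[u](@shiftNK _ _ i); apply: leq_trans (dist_shift _ _ _ _) _ => //.
have enC u : energy green u != 0 -> u \in C.
  rewrite mem_box; apply: contraNT; rewrite -ltnNge => hu.
  rewrite /energy big1 // => i _; rewrite (green_eq0 (y := u)); last lia.
  rewrite (green_eq0 (y := shift u i 1)) ?subrr ?expr0n ?mulr0 //.
  by rewrite leqNgt; apply/negP => h; have := dsh u i (ltnW h); lia.
move=> B uB; apply: (@le_trans _ _ (\sum_(u <- C) energy green u)).
  by apply: sum_le_support => // u; exact: energy_ge0.
pose a u i : R := (`[< G u (shift u i 1) >] : nat)%:R.
(* Each square splits into one term per endpoint. [K] is the term of the far endpoint, which a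
   translation then attributes to that endpoint. *)
pose K i u := a u i * (green (shift u i 1) * (green (shift u i 1) - green u)).
have -> : \sum_(u <- C) energy green u =
    \sum_(u <- C) green u * \sum_(w <- nbrs u) (`[< G u w >] : nat)%:R * (green u - green w).
  transitivity (\sum_(u <- C) \sum_i (a u i * (green u * (green u - green (shift u i 1)))
      + K i u)).
    by apply: eq_bigr => u _; apply: eq_bigr => i _; rewrite /K /a; ring.
  have KE i : \sum_(u <- C) K i u = \sum_(u <- C) K i (shift u i (-1)).
    rewrite -(big_map (fun u => shift u i (-1)) xpredT (K i)).
    apply: sum_support => //.
    - by rewrite map_inj_uniq //; exact: shift_inj.
    - move=> u Ku; rewrite mem_box (dsh _ i) // supp //.
      by apply: contraNneq Ku; rewrite /K => ->; rewrite mul0r mulr0.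
    - move=> u Ku; apply/mapP; exists (shift u i 1); last by rewrite shiftNK.
      rewrite mem_box leqW // supp //.
      by apply: contraNneq Ku; rewrite /K => ->; rewrite mul0r mulr0.
  under eq_bigr do rewrite big_split /=.
  rewrite big_split /= [X in _ + X]exchange_big /=.
  under [X in _ + X]eq_bigr do rewrite KE.
  rewrite [X in _ + X]exchange_big /= -big_split /=; apply: eq_bigr => u _.
  rewrite -big_split /= /nbrs big_allpairs_dep big_enum /= mulr_sumr.
  apply: eq_bigr => i _; rewrite !big_cons big_nil addr0 /K /a shiftKN.
  rewrite (_ : `[< G (shift u i (-1)) u >] = `[< G u (shift u i (-1)) >]); first ring.
  by apply/asboolP/asboolP; exact: edge_rel_sym.
apply: (@le_trans _ _ (\sum_(u <- C) (u == x : nat)%:R * (degree G x)%:R * green x)).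
  apply: ler_sum => u _; apply: le_trans (ler_wpM2l (green_ge0 _) (green_superharmonic u)) _.
  case: eqP => [->|]; first by rewrite mulr1 mul1r mulrC.
  by rewrite !(mulr0,mul0r).
rewrite -!mulr_suml -natr_sum (_ : (\sum_(u <- C) (u == x))%N = 1%N) ?mul1r //.
have := count_uniq_mem x uC; rewrite mem_box.
rewrite (_ : (dist x x <= N.+1)%N) => [/= <-|]; last by apply/dist_leP => l; site_lia.
by rewrite -sum1_count [RHS]big_mkcond; apply: eq_bigr => u _ /=; case: eqP.
Qed.

End Green.

Section Comparison.
Variables (h : site d -> R) (D : R).
Hypothesis hD : energy_le h D.

Lemma edge_diff (B : seq (site d)) u v : uniq B -> u \in B -> v \in B -> G u v ->
  `|h u - h v| <= Num.sqrt (\sum_(w <- B) energy h w).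
Proof.
have H u0 i : uniq B -> u0 \in B -> G u0 (shift u0 i 1) ->
    `|h u0 - h (shift u0 i 1)| <= Num.sqrt (\sum_(w <- B) energy h w).
  move=> uB u0B g; rewrite -sqrtr_sqr ler_sqrt; last by apply: sumr_ge0 => w _; exact: energy_ge0.
  rewrite (bigD1_seq u0) //= /energy (bigD1 i) //= (asboolT g) mul1r -addrA lerDl.
  by apply: addr_ge0; apply: sumr_ge0 => j _;
    rewrite ?energy_ge0 // mulr_ge0 ?ler0n ?sqr_ge0.
move=> uB uB' vB [i [[g e]|[g e]]].
  by rewrite e; apply: H => //; exists i; left.
by rewrite e distrC; apply: H => //; exists i; left.
Qed.

Lemma path_diff (B : seq (site d)) p y : uniq B ->
  path (fun u u' => `[< G u u' >]) y p -> all (mem B) (y :: p) ->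
  `|h y - h (last y p)| <= (size p)%:R * Num.sqrt (\sum_(w <- B) energy h w).
Proof.
move=> uB; elim: p y => [|z p IH] y /=; first by rewrite subrr normr0 mul0r.
move=> /andP[/asboolP yz zp] /and3P[yB zB pB].
rewrite -natr1 mulrDl mul1r [leRHS]addrC -(subrKA (h z)).
apply: le_trans (ler_normD _ _) (lerD _ _); first exact: edge_diff.
by apply: IH => //=; rewrite zB.
Qed.

Lemma linked_diff c n y z : linked S c n y z ->
  (h y - h z) ^+ 2 <= ((2 * n).+1 ^ d)%:R ^+ 2 * \sum_(w <- box c n) energy h w.
Proof.
move=> [p [yp <- pB sp]]; have := path_diff (box_uniq c n) yp pB.
set E := \sum_(w <- _) _ => hp.
have E0 : 0 <= E by apply: sumr_ge0 => w _; exact: energy_ge0.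
rewrite -real_normK ?num_real // -[X in _ * X]sqr_sqrtr // -exprMn.
rewrite lerXn2r ?nnegrE ?mulr_ge0 ?sqrtr_ge0 // (le_trans hp) //.
by rewrite ler_wpM2r ?sqrtr_ge0 ?ler_nat.
Qed.

(** Two powers of the volume come from the length of the paths. The third counts the offsets in a
    box: for a fixed offset the translates of the points of [Y] are distinct, so their energies sum
    to at most [D]. *)
Lemma sum_linked_diff (Y : seq (site d)) n i : uniq Y ->
  (forall y, y \in Y -> linked S y n y (shift y i 1)) ->
  \sum_(y <- Y) (h y - h (shift y i 1)) ^+ 2 <= ((2 * n).+1 ^ d)%:R ^+ 3 * D.
Proof.
move=> uY hY; set V := ((2 * n).+1 ^ d)%:R : R.
pose offs : seq (site d) := [seq [ffun l => (f l : nat)%:Z - n%:Z] |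
    f : {ffun 'I_d -> 'I_(2 * n).+1} <- enum {ffun 'I_d -> 'I_(2 * n).+1}].
have boxE c : box c n = map (vadd c) offs by rewrite -map_comp.
apply: (@le_trans _ _ (\sum_(y <- Y) V ^+ 2 * \sum_(v <- offs) energy h (vadd y v))).
  rewrite big_seq [leRHS]big_seq; apply: ler_sum => y /hY/linked_diff.
  by rewrite boxE big_map.
rewrite -mulr_sumr [V ^+ 3]exprSr -mulrA ler_wpM2l ?sqr_ge0 // exchange_big /=.
apply: (@le_trans _ _ (\sum_(v <- offs) D)).
  apply: ler_sum => v _; rewrite -(big_map (fun y => vadd y v) xpredT (energy h)).
  apply: hD; rewrite map_inj_uniq // => y z /ffunP yz; apply/ffunP => l.
  by have := yz l; rewrite !ffunE; exact: addIr.
rewrite big_const_seq count_predT iter_addr_0 -[leLHS]mulr_natl /V.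
by rewrite -(size_box ([ffun=> 0] : site d)) boxE size_map.
Qed.

End Comparison.
End Dirichlet.

(** * A transience criterion *)

Lemma sum_geom_le (R : realFieldType) (a : R) m n : 0 <= a < 1 ->
  \sum_(m <= s < n) a ^+ s <= (1 - a)^-1.
Proof.
move=> /andP[a0 a1].
have [nm|mn] := leqP n m.
  by rewrite big_geq // invr_ge0 subr_ge0 ltW.
apply: (@le_trans _ _ (\sum_(0 <= s < n) a ^+ s)).
  rewrite (big_cat_nat (leq0n m) (ltnW mn)) /= lerDr.
  by apply: sumr_ge0 => s _; exact: exprn_ge0.
rewrite -[leRHS]mul1r ler_pdivlMr ?subr_gt0 // mulrC big_mkord -opprB mulNr -subrX1.
by rewrite opprB lerBlDr lerDl exprn_ge0.
Qed.

Section Dyadic.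
Variables (d : nat) (d0 : (0 < d)%N).

Definition dirn (s : nat) : 'I_d := Ordinal (ltn_pmod s d0).
Definition step (s : nat) : nat := (2 ^ (s %/ d))%N.

(* [pts s] enumerates the box of side lengths [side s]: the sides are doubled
   one after the other, cyclically. *)
Fixpoint pts (s : nat) : seq (site d) :=
  if s is s'.+1 then
    pts s' ++ [seq shift y (dirn s') (step s')%:Z | y <- pts s']
  else [:: [ffun=> 0]].

(** The first [s %% d] directions have been doubled once more than the others. *)
Definition side (s : nat) (l : 'I_d) : nat := (2 ^ (s %/ d + (l < s %% d)))%N.

Lemma side_dirn s : side s (dirn s) = step s.
Proof. by rewrite /side /= ltnn addn0. Qed.

Lemma sideS s l :
  side s.+1 l = if l == dirn s then (2 * side s l)%N else side s l.
Proof.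
rewrite /side divnS // modnS -val_eqE /=.
have := ltn_ord l; have := ltn_pmod s d0.
case: (boolP (d %| s.+1)%N) => [dv|_] sd ld.
  have e : (s %% d).+1 = d.
    apply/eqP; rewrite eqn_leq sd /=; apply: dvdn_leq => //; move: dv.
    by rewrite {1}(divn_eq s d) -addnS dvdn_addr // dvdn_mull.
  case: eqP => [->|ls]; first by rewrite ltnn ltn0 !addn0 add1n expnS.
  rewrite (_ : (l < s %% d)%N); last by lia.
  by rewrite ltn0 addn0 addnC.
rewrite add0n; case: eqP => [->|ls].
  by rewrite ltnS leqnn ltnn addn0 addn1 expnS.
by rewrite ltnS leq_eqVlt; case: eqP => //.
Qed.

Lemma ptsP s y : y \in pts s -> forall l, 0 <= y l < (side s l)%:Z.
Proof.
elim: s y => [|s IH] y /=.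
  rewrite inE => /eqP -> l; rewrite ffunE /side div0n mod0n ltn0 //=.
have s0 l : (0 < side s l)%N by rewrite expn_gt0.
rewrite mem_cat => /orP[/IH h|/mapP[z /IH h ->]] l; rewrite sideS.
  by move: (h l) (s0 l); case: eqP => _; move: (y l) (side s l) => a b; cbv beta in a; lia.
rewrite ffunE; move: (h l) (s0 l); rewrite -side_dirn; case: eqP => [->|_].
  by site_lia.
by rewrite /= mulr0 addr0.
Qed.

Lemma pts_uniq s : uniq (pts s).
Proof.
elim: s => //= s IH; rewrite cat_uniq IH map_inj_uniq ?IH; last exact: shift_inj.
rewrite andbT /=; apply/hasPn => y /mapP[z /ptsP hz ->]; apply/negP => /ptsP.
move=> /(_ (dirn s)); have := hz (dirn s); rewrite ffunE eqxx side_dirn.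
by move: (z _) => a; cbv beta in a; move: (step s) => m; lia.
Qed.

Lemma size_pts s : size (pts s) = (2 ^ s)%N.
Proof. by elim: s => //= s IH; rewrite size_cat size_map IH expnS mul2n addnn. Qed.

(** Base points of the edges on the straight segments from [pts s] to its translate in
    [pts s.+1]. *)
Definition step_edges (s : nat) : seq (site d) :=
  [seq shift y (dirn s) (t : nat)%:Z | y <- pts s, t <- iota 0 (step s)].

Section Averages.
Variables (R : realType) (S : set (site d * 'I_d)) (h : site d -> R) (D : R).
Hypothesis hD : energy_le S h D.

Definition average s : R := (2 ^- s) * \sum_(y <- pts s) h y.

Lemma averageS s : average s.+1 - average s =
  (2 ^- s.+1) * \sum_(y <- pts s) (h (shift y (dirn s) (step s)%:Z) - h y).
Proof.
rewrite /average /= big_cat big_map sumrB exprS invfM /=.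
set A := \sum_(i <- _) h i; set B := \sum_(i <- _) _.
have e : 2 ^- s != 0 :> R by rewrite invr_eq0 expf_neq0.
by set p := 2 ^- s; field.
Qed.

(** Cauchy-Schwarz is used twice, over the points of [pts s] and over the [step s] edges of each
    segment. For a fixed position on the segments the base points are distinct, so [sum_linked_diff]
    applies. *)
Lemma average_step n s :
  (forall y, y \in step_edges s -> linked S y n y (shift y (dirn s) 1)) ->
  (average s.+1 - average s) ^+ 2 <=
    2 ^- s * (step s)%:R ^+ 2 * ((2 * n).+1 ^ d)%:R ^+ 3 * D.
Proof.
move=> lk; set V := ((2 * n).+1 ^ d)%:R : R; set i := dirn s; set m := step s.
have D0 : 0 <= D.
  by have := hD (B := [::]) isT; rewrite big_nil.
have V0 : 0 <= V by rewrite ler0n.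
pose f y t := h (shift y i (t : nat)%:Z).
have tele y : h (shift y i m%:Z) - h y = \sum_(t <- iota 0 m) (f y t.+1 - f y t).
  rewrite (_ : iota 0 m = index_iota 0 m); last by rewrite /index_iota subn0.
  rewrite telescope_sumr // /f; congr (_ - h _).
  by apply/ffunP => l; rewrite ffunE mul0r addr0.
have inner t : (t < m)%N -> \sum_(y <- pts s) (f y t.+1 - f y t) ^+ 2 <= V ^+ 3 * D.
  move=> tm; pose Y := [seq shift y i t%:Z | y <- pts s].
  have := @sum_linked_diff _ _ _ _ _ hD Y n i _ _.
  rewrite big_map => H; apply: le_trans (H _ _).
  - rewrite le_eqVlt; apply/orP; left; apply/eqP; apply: eq_bigr => y _.
    rewrite -sqrrN opprB /f; congr ((_ - h _) ^+ 2).
    by apply/ffunP => l; rewrite !ffunE; case: (l == i); site_lia.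
  - by rewrite map_inj_uniq ?pts_uniq //; exact: shift_inj.
  - move=> y /mapP[z zs ->]; apply: lk; apply/allpairsP; exists (z, t).
    by rewrite mem_iota.
have outer : \sum_(y <- pts s) (h (shift y i m%:Z) - h y) ^+ 2 <=
    m%:R ^+ 2 * (V ^+ 3 * D).
  apply: (@le_trans _ _ (\sum_(y <- pts s) m%:R * \sum_(t <- iota 0 m) (f y t.+1 - f y t) ^+ 2)).
    apply: ler_sum => y _; rewrite tele.
    by have := sqr_sum_le (iota 0 m) (fun t => f y t.+1 - f y t); rewrite size_iota.
  rewrite -mulr_sumr expr2 -mulrA ler_wpM2l ?ler0n // exchange_big /=.
  apply: (@le_trans _ _ (\sum_(t <- iota 0 m) (V ^+ 3 * D))).
    rewrite big_seq [leRHS]big_seq; apply: ler_sum => t; rewrite mem_iota /=.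
    exact: inner.
  by rewrite big_const_seq count_predT iter_addr_0 size_iota -[leLHS]mulr_natl.
rewrite averageS exprMn.
have := sqr_sum_le (pts s) (fun y => h (shift y i m%:Z) - h y).
rewrite size_pts natrX => cs.
have p0 : 0 < 2 ^+ s :> R by rewrite exprn_gt0.
apply: le_trans (ler_wpM2l (sqr_ge0 _) cs) _.
apply: le_trans (ler_wpM2l (sqr_ge0 _) (ler_wpM2l (ltW p0) outer)) _.
set Z := m%:R ^+ 2 * (V ^+ 3 * D).
have -> : 2 ^- s * m%:R ^+ 2 * V ^+ 3 * D = 2 ^- s * Z by rewrite /Z !mulrA.
have Z0 : 0 <= Z by rewrite mulr_ge0 ?sqr_ge0 // mulr_ge0 // exprn_ge0.
rewrite [leLHS]mulrA ler_wpM2r // [2 ^+ s.+1]exprS invfM.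
set p := 2 ^+ s in p0 *.
have -> : (2^-1 / p) ^+ 2 * p = 4^-1 * p^-1.
  by field; rewrite gt_eqF.
by rewrite ler_piMl // ?invr_ge0 ?ltW //; lra.
Qed.

End Averages.

Section Transience.
Variables (R : realType) (S : set (site d * 'I_d)).
Notation G := (edge_rel S).

(** The length [l] of a path does not depend on [h], hence not on the killing time when [h] is a
    Green function. *)
Lemma reach_diff x y : reach G x y -> exists l : nat, forall (h : site d -> R) D,
  energy_le S h D -> `|h x - h y| <= l%:R * Num.sqrt D.
Proof.
elim=> [|u v _ [l hl] uv].
  by exists 0%N => h D _; rewrite subrr normr0 mul0r.
exists l.+1 => h D hD; rewrite -(subrKA (h u)).
rewrite -natr1 mulrDl mul1r; apply: le_trans (ler_normD _ _) (lerD _ _).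
  exact: hl.
have [<-|/eqP uv'] := pselect (u = v).
  by rewrite subrr normr0 sqrtr_ge0.
have := @edge_diff _ _ S h [:: u; v] u v; rewrite /= inE andbT !inE !eqxx orbT.
move=> /(_ uv' isT isT uv) /le_trans; apply.
have D0 : 0 <= D by have := hD [::] isT; rewrite big_nil.
by rewrite ler_sqrt //; apply: hD; rewrite /= inE uv'.
Qed.

(** The increments telescope and are dominated by a geometric series, uniformly in [s]. *)
Lemma average_descent (h : site d -> R) D (a : R) s0 s : energy_le S h D ->
  0 <= a < 1 ->
  (forall s, (s0 <= s)%N ->
    (average h s.+1 - average h s) ^+ 2 <= (a ^+ s) ^+ 2 * D) ->
  (s0 <= s)%N -> average h s0 <= average h s + (1 - a)^-1 * Num.sqrt D.
Proof.
move=> hD a01 H s0s; have /andP[a0 a1] := a01.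
apply: (@le_trans _ _ (average h s + \sum_(s0 <= t < s) a ^+ t * Num.sqrt D)).
  have D0 : 0 <= D by have := hD [::] isT; rewrite big_nil.
  have -> : average h s0 =
      average h s + \sum_(s0 <= t < s) (average h t - average h t.+1).
    rewrite (eq_bigr (fun t => - (average h t.+1 - average h t))); last first.
      by move=> t _; rewrite opprB.
    by rewrite sumrN telescope_sumr // opprB addrC subrK.
  rewrite lerD2l; apply: ler_sum_nat => t /andP[st _].
  rewrite (le_trans (ler_norm _)) // distrC -sqrtr_sqr.
  have at0 : 0 <= a ^+ t by rewrite exprn_ge0.
  rewrite -[a ^+ t](ger0_norm at0) -sqrtr_sqr -sqrtrM ?sqr_ge0 //.
  by rewrite ler_sqrt ?mulr_ge0 ?sqr_ge0 //; exact: H.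
by rewrite lerD2l -mulr_suml ler_wpM2r ?sqrtr_ge0 // sum_geom_le.
Qed.

(** Links are assumed from [s0] on only; connectedness serves to compare the value at the pole with
    the average over the fixed box [pts s0]. *)
Lemma transience_criterion (n : nat -> nat) (a : R) s0 :
  0 <= a < 1 -> graph_connected G ->
  (forall s, (s0 <= s)%N -> forall y, y \in step_edges s ->
      linked S y (n s) y (shift y (dirn s) 1)) ->
  (forall s, (s0 <= s)%N ->
    2 ^- s * (step s)%:R ^+ 2 * ((2 * n s).+1 ^ d)%:R ^+ 3 <= (a ^+ s) ^+ 2) ->
  transient R G.
Proof.
move=> a01 Gc lk en x; have /andP[a0 a1] := a01.
have [l hl] : {l : site d -> nat & forall y (h : site d -> R) D,
    energy_le S h D -> `|h x - h y| <= (l y)%:R * Num.sqrt D}.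
  by apply: (@choice _ _ (fun y l => forall (h : site d -> R) D,
    energy_le S h D -> `|h x - h y| <= l%:R * Num.sqrt D)) => y; exact: reach_diff.
(* The sum over [pts s0] is a crude upper bound for every [l y]. *)
pose C : R := (\sum_(y <- pts s0) l y)%N%:R + (1 - a)^-1.
have C0 : 0 <= C by rewrite addr_ge0 // invr_ge0 subr_ge0 ltW.
have bound N : green R S x N x <= C ^+ 2 * (2 * d)%:R.
  set h := green R S x N; set D := (degree G x)%:R * h x.
  have hD : energy_le S h D by exact: energy_green.
  have h0 y : 0 <= h y by exact: green_ge0.
  have D0 : 0 <= D by rewrite mulr_ge0.
  have hx : h x <= C * Num.sqrt D.
    have step1 : h x <= average h s0 + (\sum_(y <- pts s0) l y)%N%:R * Num.sqrt D.
      have -> : h x = 2 ^- s0 * \sum_(y <- pts s0) h x.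
        rewrite big_const_seq count_predT iter_addr_0 size_pts -[X in _ = _ * X]mulr_natl natrX.
        by rewrite mulKf // expf_neq0 // pnatr_eq0.
      have -> : (\sum_(y <- pts s0) l y)%N%:R * Num.sqrt D = 2 ^- s0 *
          \sum_(y <- pts s0) (\sum_(y <- pts s0) l y)%N%:R * Num.sqrt D.
        rewrite big_const_seq count_predT iter_addr_0 size_pts -[X in _ = _ * X]mulr_natl natrX.
        by rewrite mulKf // expf_neq0 // pnatr_eq0.
      rewrite /average -mulrDr ler_wpM2l ?invr_ge0 ?exprn_ge0 //.
      rewrite -big_split /= big_seq [leRHS]big_seq; apply: ler_sum => y ys.
      rewrite -lerBlDl (le_trans (ler_norm _)) // (le_trans (hl y h D hD)) //.
      rewrite ler_wpM2r ?sqrtr_ge0 // ler_nat (bigD1_seq y) ?pts_uniq //=.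
      exact: leq_addr.
    (* [h] has finite support and total mass [M], so its averages are at most [2 ^- s * M]; [s] is
       chosen to bring this below [e]. *)
    have step2 : average h s0 <= (1 - a)^-1 * Num.sqrt D.
      apply/ler_addgt0Pr => e e0.
      set M := \sum_(u <- box x N) h u.
      have avg s : average h s <= 2 ^- s * M.
        rewrite ler_wpM2l ?invr_ge0 ?exprn_ge0 // sum_le_support ?pts_uniq ?box_uniq //.
        move=> u; rewrite mem_box; apply: contraNT; rewrite -ltnNge => /ltnW hu.
        by rewrite /h green_eq0.
      have M0 : 0 <= M by apply: sumr_ge0 => u _; exact: h0.
      pose s := maxn s0 (Num.bound (M / e)).
      have s0s : (s0 <= s)%N by exact: leq_maxl.
      have hstep t : (s0 <= t)%N ->
          (average h t.+1 - average h t) ^+ 2 <= (a ^+ t) ^+ 2 * D.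
        move=> st; apply: le_trans (average_step hD (lk t st)) _.
        by rewrite ler_wpM2r // en.
      rewrite (le_trans (average_descent hD a01 hstep s0s)) // addrC lerD2l.
      rewrite (le_trans (avg s)) // mulrC ler_pdivrMr ?exprn_gt0 // mulrC.
      have hb : M / e < (Num.bound (M / e))%:R.
        by apply: archi_boundP; rewrite divr_ge0 // ltW.
      rewrite -ler_pdivrMr // (le_trans (ltW hb)) //.
      rewrite -natrX ler_nat (leq_trans (leq_maxr s0 _)) // -/s ltnW //.
      exact: ltn_expl.
    by rewrite /C mulrDl (le_trans step1) // addrC lerD2l.
  (* Squaring and dividing by [h x] leaves a bound free of [N]. *)
  have := ler_pM (h0 x) (h0 x) hx hx.
  rewrite -!expr2 exprMn sqr_sqrtr // /D.
  have dx : (degree G x)%:R <= (2 * d)%:R :> R by rewrite ler_nat degree_le.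
  have [->|hx0] := eqVneq (h x) 0; first by rewrite mulr_ge0 ?sqr_ge0.
  have {hx0} hx0 : 0 < h x by rewrite lt_def hx0 h0.
  rewrite mulrA expr2 ler_pM2r // => /le_trans; apply.
  by rewrite ler_wpM2l ?sqr_ge0.
apply: nondecreasing_is_cvgn.
  apply/nondecreasing_seqP => N.
  by rewrite /series /= big_nat_recr //= lerDl srw_pn_ge0.
exists (C ^+ 2 * (2 * d)%:R) => _ [N _ <-].
by rewrite /series /= big_mkord; exact: bound.
Qed.

End Transience.
End Dyadic.

(** * Summability and Borel-Cantelli *)

Lemma natr_geom_le (R : realFieldType) (a : R) (s : nat) : 0 <= a < 1 ->
  s%:R * a ^+ s <= (1 - a)^-1.
Proof.
move=> /[dup] a01 /andP[a0 a1]; apply: le_trans (sum_geom_le 0 s a01).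
rewrite big_mkord -[s in s%:R]card_ord mulr_natl -sumr_const.
by apply: ler_sum => i _; apply: ler_wiXn2l; rewrite ?(ltW a1) ?(ltnW (ltn_ord i)).
Qed.

(** Writing [a] as the square of [b] splits off one factor [s * b ^ s], bounded by [natr_geom_le],
    and leaves a smaller power of [s]. *)
Lemma poly_geom_bounded (R : rcfType) (B : nat) (a : R) : 0 <= a < 1 ->
  exists M, forall s, s%:R ^+ B * a ^+ s <= M.
Proof.
elim: B a => [|B IH] a a01; have /andP[a0 a1] := a01.
  by exists 1 => s; rewrite expr0 mul1r exprn_ile1 // ltW.
pose b := Num.sqrt a.
have b01 : 0 <= b < 1 by rewrite sqrtr_ge0 -[X in _ < X]sqrtr1 ltr_sqrt.
have [M hM] := IH b b01; have /andP[b0 b1] := b01.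
exists (M * (1 - b)^-1) => s.
rewrite -(sqr_sqrtr a0) -/b -exprM mulnC exprM exprSr expr2 mulrACA.
by rewrite ler_pM ?natr_geom_le // mulr_ge0 ?exprn_ge0 ?ler0n.
Qed.

(** The bound for the exponent [B.+1] provides a spare factor [s], which eventually exceeds
    [A * M]. *)
Lemma poly_geom_eventually (R : realType) (A : R) (B : nat) (a : R) :
  0 <= a < 1 ->
  exists N : nat, forall s, (N <= s)%N -> A * (s%:R ^+ B * a ^+ s) <= 1.
Proof.
move=> a01; have /andP[a0 a1] := a01.
have [A0|A0] := leP A 0.
  exists 0%N => s _; apply: (@le_trans _ _ 0) => //.
  by rewrite mulr_le0_ge0 // mulr_ge0 ?exprn_ge0.
have [M hM] := poly_geom_bounded B.+1 a01.
have M0 : 0 <= M by apply: le_trans (hM 0%N); rewrite exprS mul0r mul0r.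
exists (Num.bound (A * M)).+1 => s hs.
have s0 : 0 < s%:R :> R by rewrite ltr0n; lia.
have AM : A * M < s%:R.
  have : A * M < (Num.bound (A * M))%:R by apply: archi_boundP; rewrite mulr_ge0 // ltW.
  by move=> /lt_le_trans; apply; rewrite ler_nat ltnW.
rewrite -(ler_pM2l s0) mulr1 (le_trans _ (ltW AM)) //.
by rewrite mulrCA ler_wpM2l ?(ltW A0) // mulrA -exprS.
Qed.

Lemma leq_addX a b s : (a ^ s.+1 + b ^ s.+1 <= (a + b) ^ s.+1)%N.
Proof.
elim: s => [|s IH]; first by rewrite !expn1.
rewrite expnS [(b ^ _)%N]expnS [((a + b) ^ _)%N]expnS.
by apply: leq_trans (leq_mul (leqnn _) IH); rewrite mulnDl !mulnDr; lia.
Qed.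

Lemma reach_trans (V : Type) (G : V -> V -> Prop) x y z :
  reach G x y -> reach G y z -> reach G x z.
Proof. by move=> xy; elim=> // u v _ xu uv; exact: reach_step xu uv. Qed.

Lemma reach_sym d (S : set (site d * 'I_d)) x y :
  reach (edge_rel S) x y -> reach (edge_rel S) y x.
Proof.
elim=> [|u v _ ux uv]; first exact: reach_refl.
apply: reach_trans ux; apply: reach_step (reach_refl _ _) _.
exact: edge_rel_sym.
Qed.

Lemma linked_reach d (S : set (site d * 'I_d)) c n y z : linked S c n y z ->
  reach (edge_rel S) y z.
Proof.
move=> [p [+ <- _ _]]; elim: p y => [|u p IH] y /=; first by move=> _; exact: reach_refl.
move=> /andP[/asboolP yu /IH]; apply: reach_trans.
exact: reach_step (reach_refl _ _) yu.
Qed.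

Lemma connected_of_steps d (S : set (site d * 'I_d)) :
  (forall y i, reach (edge_rel S) y (shift y i 1)) -> graph_connected (edge_rel S).
Proof.
move=> st.
suff H m (y : site d) : (\sum_l absz (y l) <= m)%N -> reach (edge_rel S) y [ffun=> 0].
  by move=> x y; apply: reach_trans (H _ _ (leqnn _)) (reach_sym (H _ _ (leqnn _))).
elim: m y => [|m IH] y hy.
  rewrite (_ : y = [ffun=> 0]); first exact: reach_refl.
  apply/ffunP => l; rewrite ffunE; move: hy; rewrite leqn0 sum_nat_eq0.
  by move=> /forallP/(_ l)/=; rewrite absz_eq0 => /eqP.
have [y0|] := pselect (forall l, y l = 0).
  by rewrite (_ : y = [ffun=> 0]); [exact: reach_refl|apply/ffunP => l; rewrite ffunE].
move=> /existsNP[l /eqP yl].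
have red (s : int) : (absz (y l + s)%R < absz (y l))%N ->
    reach (edge_rel S) (shift y l s) [ffun=> 0].
  move=> hs; apply: IH; rewrite -ltnS; apply: leq_trans hy.
  rewrite (bigD1 l) //= [X in (_ < X)%N](bigD1 l) //= !ffunE eqxx mulr1.
  rewrite -addSn leq_add // leq_sum // => j jl.
  by rewrite ffunE (negPf jl) mulr0 addr0.
have [yp|yn] := leP 0 (y l).
  apply: reach_trans (red (-1) _); last by move: yp yl; move: (y l) => a; cbv beta in a; lia.
  by apply: reach_sym; rewrite -[X in reach _ _ X](@shiftKN _ y l).
apply: reach_trans (st y l) (red 1 _).
by move: yn; move: (y l) => a; cbv beta in a; lia.
Qed.

(** The events are replaced by measurable covers, empty below [N], and [Z] is the upper limit of the
    covers. *)
Lemma borel_cantelli_outer (R : realType) (dm : measure_display)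
    (Omega : measurableType dm) (P : probability Omega R)
    (E : nat -> set Omega) (N : nat) :
  (forall s, (N <= s)%N -> outer_le P (E s) (2 ^- s)) ->
  exists Z, [/\ measurable Z, P Z = 0%E &
    forall om, ~ Z om -> exists s0, forall s, (s0 <= s)%N -> ~ E s om].
Proof.
move=> h.
have [F hF] : {F : nat -> set Omega & forall s, [/\ measurable (F s),
    ((N <= s)%N -> E s `<=` F s) & (P (F s) <= (2 ^- s)%:E)%E]}.
  apply: (@choice _ _ (fun s Fs => [/\ measurable Fs,
    ((N <= s)%N -> E s `<=` Fs) & (P Fs <= (2 ^- s)%:E)%E])) => s.
  have [Ns|sN] := leqP N s.
    by have [B [mB EB PB]] := h s Ns; exists B.
  by exists set0; rewrite measure0 lee_fin invr_ge0 exprn_ge0.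
have mF s : measurable (F s) by have [] := hF s.
exists (lim_sup_set F); split.
- by apply: bigcap_measurable => // m _; apply: bigcup_measurable.
- apply: lim_sup_set_cvg0 => //.
  apply: (@le_lt_trans _ _ 2%:E); last exact: ltry.
  apply: lime_le; first exact: is_cvg_nneseries.
  apply: nearW => m.
  apply: (@le_trans _ _ (\sum_(0 <= s < m) (2 ^- s)%:E)%E).
    by apply: lee_sum => s _; have [] := hF s.
  rewrite sumEFin lee_fin.
  have := @sum_geom_le R 2^-1 0 m; rewrite (_ : (1 - 2^-1)^-1 = 2 :> R); last by field.
  move=> H; under eq_bigr do rewrite -exprVn; apply: H; lra.
- move=> om hom; apply: contrapT => hno; apply: hom => m _.
  have := hno; rewrite -forallNE => /(_ (maxn m N)) /existsNP[s /not_implyP[ms]].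
  move=> /contrapT Es; exists s => /=; first by rewrite (leq_trans (leq_maxl m N)).
  by have [_ EF _] := hF s; apply: EF => //; rewrite (leq_trans (leq_maxr m N)).
Qed.

(** * Proof of the theorem *)

(** The radius for [q = s] and [2d + 1] stages. It is of order [s ^ 2], so the volume, of order
    [s ^ (2 * d)], is eventually below [q ^ T]. *)
Definition scale (d k s : nat) : nat := tau k s (2 * d).+1 0.
Definition scale_const (d k : nat) : nat := (8 * k * (2 * d).+1 + 3)%N.

Lemma scale_le d k s : (1 <= s)%N ->
  ((2 * scale d k s).+1 ^ d <= scale_const d k ^ d * s ^ (2 * d))%N.
Proof.
move=> s1; rewrite expnM -expnMn.
suff H : ((2 * scale d k s).+1 <= scale_const d k * s ^ 2)%N.
  by case: (posnP d) => [->|d0]; rewrite ?expn0 ?leq_exp2r.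
rewrite /scale /tau subn0 /scale_const mulnDl.
have : (0 < s ^ 2)%N by rewrite expn_gt0 s1.
by move: (s ^ 2)%N => t t0; nia.
Qed.

Lemma scale_lt d k s : (scale_const d k ^ d < s)%N ->
  ((2 * scale d k s).+1 ^ d < s ^ (2 * d).+1)%N.
Proof.
move=> hs; have s1 : (1 <= s)%N by apply: leq_ltn_trans hs.
apply: leq_ltn_trans (scale_le d k s1) _.
by rewrite expnS ltn_mul2r expn_gt0 s1.
Qed.

(** The first list serves transience; the boxes, which exhaust the lattice, serve connectedness. *)
Definition centers d (d0 : (0 < d)%N) (s : nat) : seq (site d) :=
  step_edges d0 s ++ box [ffun=> 0] s.

(** The bound has the form of an [s]-th power, to be merged with the other factors of the union
    bound. *)
Lemma size_centers d (d0 : (0 < d)%N) s : (1 <= s)%N ->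
  (size (centers d0 s) <= (4 + 3 ^ d * s ^ d) ^ s)%N.
Proof.
move=> s1; rewrite size_cat size_allpairs size_pts size_iota size_box.
have -> : s = s.-1.+1 by lia.
apply: leq_trans (leq_addX _ _ _); set r := s.-1.+1; have r1 : (1 <= r)%N by [].
apply: leq_add.
  rewrite (_ : 4 = 2 * 2)%N // expnMn leq_mul // leq_exp2l //.
  exact: leq_div.
apply: (@leq_trans (3 ^ d * r ^ d)).
  rewrite -expnMn; case: (d) => // m; rewrite leq_exp2r //; lia.
by rewrite -[leqLHS]expn1 leq_pexp2l // -expnMn expn_gt0 muln_gt0.
Qed.

Section Main.
Variables (R : realType) (d k : nat) (eps : R).
Variables (dm : measure_display) (Omega : measurableType dm).
Variables (P : probability Omega R) (X : site d -> Omega -> Qcode d k * bool).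
Variable Lambda : set (site d * 'I_d).
Hypothesis (d3 : (3 <= d)%N) (k1 : (1 <= k)%N) (eps01 : 0 < eps <= 1).
Hypothesis Linf : everywhere_percolating Lambda.
Hypothesis HX : box_choices P eps X.

Let d2 : (2 <= d)%N := ltnW d3.
Let d0 : (0 < d)%N := ltnW d2.

Definition unlinked_at (s : nat) : set Omega :=
  [set om | exists2 y, y \in centers d0 s &
    ~ forall i, linked (Lambda `|` phi X om) y (scale d k s) y (shift y i 1)].

Lemma unlinked_at_prob : exists N, forall s, (N <= s)%N ->
  outer_le P (unlinked_at s) (2 ^- s).
Proof.
have Q0 := Qset_gt0 d2 k1.
have Q0' : 0 < #|Qset d k|%:R :> R by rewrite ltr0n.
have /andP[e0 e1] := eps01.
set a := 1 - eps / #|Qset d k|%:R.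
have a01 : 0 <= a < 1.
  rewrite subr_ge0 ler_pdivrMr // mul1r (le_trans e1) ?ler1n //=.
  by rewrite ltrBlDr ltrDl divr_gt0.
have /andP[a0 a1] := a01.
pose C := scale_const d k.
(* The union bound becomes the [s]-th power of a polynomial times [a ^ s]. The factor [2] brings
   this base below one half; the degree is [2 * d] from the volume plus [d] from the number of
   centres. *)
pose A : R := 2 * ((2 * d).+1 * C ^ d * (4 + 3 ^ d))%N%:R.
have [N hN] := poly_geom_eventually A (2 * d + d) a01.
exists (maxn N (C ^ d)).+1 => s; rewrite gtn_max => /andP[Ns Cs].
have s1 : (1 <= s)%N by apply: leq_ltn_trans Ns.
have H (y : site d) : outer_le P [set om | ~ forall i,
    linked (Lambda `|` phi X om) y (scale d k s) y (shift y i 1)]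
   ((2 * d).+1%:R * ((2 * scale d k s).+1 ^ d)%:R ^+ s * a ^+ (s ^ 2)).
  exact: unlinked_prob d2 k1 eps01 Linf HX (scale_lt Cs).
have := outer_le_seq (s := centers d0 s) (fun y _ => H y).
apply: outer_le_sub => //.
rewrite big_const_seq count_predT iter_addr_0 -[leLHS]mulr_natl.
set V := ((2 * _).+1 ^ d)%N.
apply: (@le_trans _ _ ((((4 + 3 ^ d * s ^ d) * (2 * d).+1 * V)%N%:R * a ^+ s) ^+ s)).
  rewrite exprMn -exprM mulnn !mulrA ler_wpM2r ?exprn_ge0 //.
  rewrite -natrX -!natrM -natrX ler_nat !expnMn leq_mul //.
  rewrite leq_mul ?size_centers //.
  by rewrite -[leqLHS]expn1 leq_pexp2l.
rewrite -exprVn lerXn2r ?nnegrE ?mulr_ge0 ?exprn_ge0 ?invr_ge0 //.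
have := hN s (ltnW Ns); rewrite /A mulrA -natrX -mulrA => h.
rewrite -(ler_pM2l (ltr0n R 2)) divff // mulrA -natrM.
apply: le_trans h; rewrite !mulrA -!natrM ler_wpM2r ?exprn_ge0 // ler_nat.
rewrite -!mulnA leq_mul2l /= mulnCA leq_mul2l /=.
rewrite [leqRHS]mulnCA [leqRHS]mulnC expnD.
have : (4 + 3 ^ d * s ^ d <= (4 + 3 ^ d) * s ^ d)%N.
  by rewrite mulnDl leq_add2r leq_pmulr // expn_gt0 s1.
move/leq_mul => /(_ _ _ (scale_le d k s1))/leq_trans; apply.
by rewrite -/C; apply/eq_leq; ring.
Qed.

Lemma scale_energy : exists N, forall s, (N <= s)%N ->
  2 ^- s * (step d s)%:R ^+ 2 * ((2 * scale d k s).+1 ^ d)%:R ^+ 3 <=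
  ((9 / 10) ^+ s) ^+ 2 :> R.
Proof.
pose C := scale_const d k.
have [|N hN] := @poly_geom_eventually R ((C ^ d)%N%:R ^+ 3) (6 * d) (80 / 81).
  by apply/andP; split; lra.
exists N.+1 => s Ns; have s1 : (1 <= s)%N by apply: leq_ltn_trans Ns.
set V := ((2 * _).+1 ^ d)%N.
have hV : V%:R ^+ 3 <= (C ^ d)%N%:R ^+ 3 * s%:R ^+ (6 * d) :> R.
  have -> : s%:R ^+ (6 * d) = (s ^ (2 * d))%N%:R ^+ 3 :> R.
    by rewrite natrX -exprM; congr (_ ^+ _); lia.
  rewrite -exprMn -natrM lerXn2r ?nnegrE // ler_nat.
  exact: scale_le.
(* This is where [d >= 3] enters: the left side is at most [4 ^ (s / 3)], and [4] is below the cube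
   of [8 / 5]. Since [8 / 5 < 2], the factor [2 ^- s] wins, and [81 / 80] is the room left for the
   polynomial. *)
have hstep : (step d s)%:R ^+ 2 <= (8 / 5) ^+ s :> R.
  rewrite /step natrX -exprM mulnC exprM.
  apply: (@le_trans _ _ (((8 / 5) ^+ 3) ^+ (s %/ d))).
    by rewrite lerXn2r ?nnegrE //; lra.
  rewrite -exprM ler_weXn2l //; first lra.
  by rewrite mulnC (leq_trans (leq_mul (leqnn _) d3)) // leq_divM.
have -> : ((9 / 10) ^+ s) ^+ 2 = 2 ^- s * (8 / 5) ^+ s * (81 / 80) ^+ s :> R.
  rewrite -exprM mulnC exprM -exprVn -!exprMn; congr (_ ^+ _); by field.
rewrite ler_pM ?mulr_ge0 ?invr_ge0 ?exprn_ge0 //.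
  by rewrite ler_wpM2l ?invr_ge0 ?exprn_ge0.
apply: le_trans hV _.
have := hN s (ltnW Ns).
rewrite mulrA (_ : (80 / 81) ^+ s = ((81 / 80) ^+ s)^-1 :> R); last first.
  by rewrite -exprVn; congr (_ ^+ _); field.
by rewrite ler_pdivrMr ?exprn_gt0 ?mul1r //; lra.
Qed.

Lemma connected_transient_ae :
  {ae P, forall om,
     graph_connected (edge_rel (Lambda `|` phi X om)) /\
     transient R (edge_rel (Lambda `|` phi X om))}.
Proof.
have [N hN] := unlinked_at_prob.
have [Z [mZ PZ hZ]] := borel_cantelli_outer hN.
exists Z; split=> // om /= hom; apply: contrapT => /hZ[s0 hs0]; apply: hom.
have [s1 hs1] := scale_energy.
have lk s y i : (s0 <= s)%N -> y \in centers d0 s ->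
    linked (Lambda `|` phi X om) y (scale d k s) y (shift y i 1).
  move=> ss ys; have := hs0 s ss; apply: contra_notP => h.
  by exists y => // /(_ i).
have conn : graph_connected (edge_rel (Lambda `|` phi X om)).
  apply: connected_of_steps => y i.
  (* The index is large enough both for Borel-Cantelli and for [y] to lie in the box of
     [centers]. *)
  apply: (@linked_reach _ _ y (scale d k (maxn s0 (dist [ffun=> 0] y)))).
  apply: lk; first exact: leq_maxl.
  by rewrite mem_cat mem_box leq_maxr orbT.
split=> //.
apply: (@transience_criterion _ d0 _ _ (scale d k) (9 / 10) (maxn s0 s1)) => //.
- by apply/andP; split; lra.
- move=> s; rewrite geq_max => /andP[ss _] y ys; apply: lk => //.
  by rewrite mem_cat ys.
- by move=> s; rewrite geq_max => /andP[_ ss]; exact: hs1.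
Qed.

End Main.

Theorem theorem1p6 (R : realType) (d k : nat) (eps : R)
  (dm : measure_display) (Omega : measurableType dm) (P : probability Omega R)
  (X : site d -> Omega -> Qcode d k * bool)
  (Lambda : set (site d * 'I_d)) :
  (3 <= d)%N -> (1 <= k)%N -> 0 < eps <= 1 ->
  everywhere_percolating Lambda ->
  box_choices P eps X ->
  {ae P, forall om,
     graph_connected (edge_rel (Lambda `|` phi X om)) /\
     transient R (edge_rel (Lambda `|` phi X om))}.
Proof.
move=> d3 k1 e01 Linf HX; exact: (connected_transient_ae d3 k1 e01 Linf HX).
Qed.
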